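(* Consider the stochastic energy exchange model, the functions $V,W$, the constant $M_0$, the set $G$ and the $G$-induced chain $\hat{\mathbf{E}}_n$ with kernel $\hat P$ described in the context. There exist constants $M_1>1$ and $\delta>0$ such that $$\hat PW(\mathbf{E})\le(1-\delta)W(\mathbf{E})$$ for every $\mathbf{E}\in G$ with $W(\mathbf{E})>M_1$.
   Context: Fix $N\ge1$, $T_L,T_R>0$, a sufficiently large $K$ ($K\gg T_L,T_R$) and $R(a,b)=\min\{K,\sqrt{\min(a,b)}\}$. The stochastic energy exchange model is the Markov jump process $\mathbf{E}_t=(E_1(t),\dots,E_N(t))$ on $\mathbb{R}^N_+$: for $i=1,\dots,N-1$ a clock of rate $R(E_i,E_{i+1})$ on sites $i,i+1$; when it rings $(E_i,E_{i+1})\mapsto(p(E_i+E_{i+1}),(1-p)(E_i+E_{i+1}))$, $p$ uniform on $(0,1)$; a clock of rate $R(T_L,E_1)$ (resp. $R(E_N,T_R)$) with $E_1\mapsto p(E_1+X_L)$ (resp. $E_N\mapsto p(E_N+X_R)$), $X_L,X_R$ exponential with means $T_L,T_R$; all independent. $P^t$ is its transition kernel. Let $W(\mathbf{E})=\sum_{i=1}^N E_i$, $a_m=1-\frac{2^{m-1}-1}{2^N-1}$, and for small $\eta>0$, $V(\mathbf{E})=\sum_{m=1}^N\sum_{k=1}^{N-m+1}\big(\sum_{j=0}^{m-1}E_{k+j}\big)^{a_m\eta-1}$. Fix sufficiently small $\eta>0$ and $h>0$, and a constant $M_0>1$ such that $P^hV(\mathbf{E})-V(\mathbf{E})\le-c_0V(\mathbf{E})^{\alpha}$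 whenever $V(\mathbf{E})>M_0$, for some $c_0>0$, $\alpha=1-\frac{1}{2(1-\eta)}$. Let $G=\{\mathbf{E}:V(\mathbf{E})\le M_0\}$. The time-$h$ sampling chain is $\mathbf{E}_n:=\mathbf{E}_{nh}$; let $T_0=0$, $T_{n+1}=\inf\{k>T_n:\mathbf{E}_{kh}\in G\}$ and $\hat{\mathbf{E}}_n=\mathbf{E}_{T_nh}$, the $G$-induced chain, with transition kernel $\hat P$, so $\hat PW(\mathbf{E})=\mathbb{E}_{\mathbf{E}}[W(\mathbf{E}_{T_1h})]$. *)

(* Defs.v *)
From mathcomp Require Import all_boot all_order all_algebra.
From mathcomp Require Import all_classical all_reals all_analysis.
Set Implicit Arguments. Unset Strict Implicit. Unset Printing Implicit Defensive.
Import Order.TTheory GRing.Theory Num.Theory.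
Local Open Scope classical_set_scope.
Local Open Scope ring_scope.

Section SEE.
Variable R : realType.

(* States: E : nat -> R; sites are 0,...,N-1 (site i+1 of the paper is index i). *)
Definition state := nat -> R.

Definition posstate (N : nat) (E : state) : Prop := forall i, (i < N)%N -> 0 < E i.

Definition rate (K a b : R) : R := Num.min K (Num.sqrt (Num.min a b)).

Definition upd2 (E : state) (i : nat) (p : R) : state :=
  fun j => if j == i then p * (E i + E i.+1)
           else if j == i.+1 then (1 - p) * (E i + E i.+1) else E j.

Definition upd1 (E : state) (i : nat) (v : R) : state :=
  fun j => if j == i then v else E j.

Definition expdens (T x : R) : R := T^-1 * expR (- (x / T)).

(* uniformisation constant: N+1 clocks, each of rate <= K *)
Definition lam (N : nat) (K : R) : R := (N.+1)%:R * K.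

Definition totrate (N : nat) (TL TR K : R) (E : state) : R :=
  \sum_(i < N.-1) rate K (E i) (E i.+1) + rate K TL (E 0%N) + rate K (E N.-1) TR.

Local Open Scope ereal_scope.

(* One step of the uniformised (discrete skeleton) kernel, acting on
   nonnegative extended-real functions. *)
Definition Qop (N : nat) (TL TR K : R) (f : state -> \bar R) : state -> \bar R :=
  fun E =>
  ((lam N K)^-1)%:E *
  ( (\sum_(i < N.-1)
        (rate K (E i) (E i.+1))%:E *
        \int[lebesgue_measure]_(p in `]0%R, 1%R[) f (upd2 E i p))
  + (rate K TL (E 0%N))%:E *
        \int[lebesgue_measure]_(p in `]0%R, 1%R[)
          \int[lebesgue_measure]_(x in `]0%R, +oo[)
             ((expdens TL x)%:E * f (upd1 E 0 (p * (E 0%N + x))))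
  + (rate K (E N.-1) TR)%:E *
        \int[lebesgue_measure]_(p in `]0%R, 1%R[)
          \int[lebesgue_measure]_(x in `]0%R, +oo[)
             ((expdens TR x)%:E * f (upd1 E N.-1 (p * (E N.-1 + x))))
  + (lam N K - totrate N TL TR K E)%:E * f E ).

(* Transition semigroup P^t of the jump process (uniformisation formula):
   P^t f = sum_n e^{-lam t} (lam t)^n / n! Q^n f. *)
Definition Pt (N : nat) (TL TR K t : R) (f : state -> \bar R) : state -> \bar R :=
  fun E => \sum_(n <oo)
     ((expR (- (lam N K * t)) * (lam N K * t) ^+ n / (n`!)%:R)%:E
       * iter n (Qop N TL TR K) f E).

Definition W (N : nat) (E : state) : R := \sum_(i < N) E i.

Local Close Scope ereal_scope.

Definition a_coef (N m : nat) : R :=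
  1 - ((2 ^ m.-1)%:R - 1) / ((2 ^ N)%:R - 1).

Definition Vfun (N : nat) (eta : R) (E : state) : R :=
  \sum_(1 <= m < N.+1) \sum_(0 <= k < N - m + 1)
     (\sum_(0 <= j < m) E (k + j)%N) `^ (a_coef N m * eta - 1).

Definition alpha (eta : R) : R := 1 - (2 * (1 - eta))^-1.

Definition Gset (N : nat) (eta M0 : R) : set state :=
  [set E | posstate N E /\ Vfun N eta E <= M0].

Local Open Scope ereal_scope.

(* Kernel of the G-induced chain of the time-h sampling chain:
   hat P f(E) = E_E[f(E_{T_1 h})]
             = sum_{k>=1} (P^h 1_{G^c})^{k-1} P^h (1_G f) (E). *)
Definition Phat (N : nat) (TL TR K h eta M0 : R) (f : state -> \bar R)
  : state -> \bar R :=
  fun E => \sum_(k <oo)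
    iter k (fun g => Pt N TL TR K h
                       (fun y => if `[< Gset N eta M0 y >] then 0 else g y))
      (Pt N TL TR K h (fun y => if `[< Gset N eta M0 y >] then f y else 0)) E.

End SEE.

(* Main.v *)
(* Write Q for the uniformised one-step kernel. Since the exchanges preserve W
   and each bath takes away half of the energy of its site and brings in a
   bounded amount, Q W <= W + const. If all energies are at least eps, the energy
   of any site reaches the left bath with positive probability within N steps,
   so P^h W <= W - d W + const on G, where V <= M0 bounds the energies below.
   Outside G the drift hypothesis gives P^h V <= V - c0, so W + D V with D c0
   larger than the growth constant of W is a supersolution for the excursion and
   dominates the sum defining the induced kernel there. Finally P^h V <= const V
   because negative powers of exponent greater than -1 are integrable in p, so an
   excursion started in G costs only a constant, negligible against d W.

   The iterates of Q are not known to be measurable along the integration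
   variables. On nonnegative functions the library integral is then a lower
   integral, which is still monotone, positively homogeneous and superadditive,
   and subadditive when one of the two summands is measurable; this suffices. *)

Require Import Defs.
From mathcomp Require Import all_boot all_order all_algebra.
From mathcomp Require Import all_classical all_reals all_analysis.
From mathcomp Require Import measurable_realfun simple_functions ring lra.
Set Implicit Arguments. Unset Strict Implicit. Unset Printing Implicit Defensive.
Import Order.TTheory GRing.Theory Num.Theory.
Import numFieldNormedType.Exports.
Local Open Scope classical_set_scope.
Local Open Scope ring_scope.

(** * Lower integrals of nonnegative functions *)

Section lower_integral.
Local Open Scope ereal_scope.
Context d (T : measurableType d) (R : realType).
Variables (mu : {measure set T -> \bar R}) (D : set T).
Hypothesis mD : measurable D.
Implicit Types f g : T -> \bar R.

Import HBNNSimple.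

(** The integral of a nonnegative function is a supremum over simple functions below it, and each of
    these is itself a measurable minorant. Measurability of [f] is never invoked. *)
Lemma integral_le_minorants f (y : \bar R) :
  (forall x, D x -> 0 <= f x) ->
  (forall g, measurable_fun D g -> (forall x, D x -> 0 <= g x) ->
     (forall x, D x -> g x <= f x) -> \int[mu]_(x in D) g x <= y) ->
  \int[mu]_(x in D) f x <= y.
Proof.
move=> f0 H; rewrite ge0_integralE//; apply/ge_ereal_sup => /= _ [h /= hf <-].
(* [f] is extended by zero off [D], so a nonnegative simple function below it vanishes there and has
   the same integral over [D] as over the whole space. *)
have h0 x : ~ D x -> h x = 0%R.
  move=> nDx; apply/eqP; rewrite eq_le fun_ge0 andbT -lee_fin.
  by have := hf x; rewrite patchE memNset.
have -> : sintegral mu h = \int[mu]_(x in D) (h x)%:E.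
  rewrite integral_nnsfun//; congr sintegral; apply/funext => x.
  rewrite patchE; case: ifPn => // /negP xD; apply: h0 => Dx; apply: xD.
  exact: mem_set.
apply: H.
- by apply/measurable_EFinP; exact: measurable_funTS.
- by move=> x _; rewrite lee_fin fun_ge0.
- by move=> x Dx; have := hf x; rewrite patchE mem_set.
Qed.

Lemma integral_ge0_mono f g : (forall x, D x -> 0 <= f x) ->
  (forall x, D x -> f x <= g x) ->
  \int[mu]_(x in D) f x <= \int[mu]_(x in D) g x.
Proof.
move=> f0 fg; rewrite !ge0_integralE//; last first.
  by move=> x Dx; exact: le_trans (f0 _ Dx) (fg _ Dx).
apply/ge_ereal_sup => /= _ [h /= hf <-]; apply: ereal_sup_ubound.
exists h => //= x; apply: le_trans (hf x) _.
by rewrite !patchE; case: ifPn => //; rewrite inE => /fg.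
Qed.

(** The sum of measurable minorants of [f] and of [g] is a measurable minorant of the sum; the two
    suprema are taken one after the other. *)
Lemma integral_superadd f g : (forall x, D x -> 0 <= f x) ->
  (forall x, D x -> 0 <= g x) ->
  \int[mu]_(x in D) f x + \int[mu]_(x in D) g x <=
  \int[mu]_(x in D) (f x + g x).
Proof.
move=> f0 g0; set y := \int[mu]_(x in D) (f x + g x).
have fg0 x : D x -> 0 <= f x + g x by move=> Dx; rewrite adde_ge0 ?f0 ?g0.
(* Once [y] is finite, so are all integrals below it, which allows moving them across the
   inequality. *)
have [yoo|yfin] := eqVneq y +oo; first by rewrite yoo leey.
have fin k : (forall x, D x -> 0 <= k x) -> (forall x, D x -> k x <= f x + g x) ->
    \int[mu]_(x in D) k x \is a fin_num.
  move=> k0 kfg; have k0' := integral_ge0 mu k0.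
  rewrite ge0_fin_numE//; apply: le_lt_trans (_ : _ <= y) _; last by rewrite ltey.
  exact: integral_ge0_mono.
have gfin : \int[mu]_(x in D) g x \is a fin_num.
  by apply: fin => // x Dx; rewrite leeDr ?f0.
rewrite -leeBrDr//; apply: integral_le_minorants => // f' mf' f'0 f'f.
have f'fin : \int[mu]_(x in D) f' x \is a fin_num.
  by apply: fin => // x Dx; rewrite (le_trans (f'f _ Dx))// leeDl ?g0.
rewrite leeBrDr// addeC -leeBrDr//.
apply: integral_le_minorants => // g' mg' g'0 g'g.
rewrite leeBrDr// addeC -ge0_integralD//; apply: integral_ge0_mono.
- by move=> x Dx; rewrite adde_ge0 ?f'0 ?g'0.
- by move=> x Dx; rewrite leeD ?f'f ?g'g.
Qed.

Lemma integral_scale_le f (c : R) : (0 < c)%R -> (forall x, D x -> 0 <= f x) ->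
  \int[mu]_(x in D) (c%:E * f x) <= c%:E * \int[mu]_(x in D) f x.
Proof.
move=> c0 f0.
apply: integral_le_minorants => [x Dx|g mg g0 gf].
  by rewrite mule_ge0 ?f0// lee_fin ltW.
rewrite -lee_pdivrMl// -ge0_integralZl//; last by rewrite lee_fin invr_ge0 ltW.
apply: integral_ge0_mono => x Dx.
  by rewrite mule_ge0 ?g0// lee_fin invr_ge0 ltW.
by rewrite lee_pdivrMl// gf.
Qed.

(* One summand measurable is enough for subadditivity of the lower integral:
   a minorant of [g + f], minus [g], is a measurable minorant of [f]. *)
Lemma integral_subadd (F f : T -> \bar R) (g : T -> R) (a : \bar R) :
  (forall x, D x -> 0 <= f x) -> (forall x, D x -> (0 <= g x)%R) ->
  measurable_fun D g -> (forall x, D x -> 0 <= F x) ->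
  (forall x, D x -> F x <= (g x)%:E + f x) ->
  \int[mu]_(x in D) (g x)%:E <= a ->
  \int[mu]_(x in D) F x <= a + \int[mu]_(x in D) f x.
Proof.
move=> f0 g0 mg F0 Fgf ga.
apply: integral_le_minorants => // k mk k0 kF.
pose r x := maxe (k x - (g x)%:E) 0.
have mEg : measurable_fun D (EFin \o g) by exact/measurable_EFinP.
have mr : measurable_fun D r.
  by apply: measurable_maxe => //; apply: emeasurable_funB.
have r0 x : D x -> 0 <= r x by move=> _; rewrite le_max lexx orbT.
apply: (@le_trans _ _ (\int[mu]_(x in D) ((g x)%:E + r x))).
  apply: integral_ge0_mono => // x Dx.
  by rewrite addeC -leeBlDr// le_max lexx.
rewrite ge0_integralD//.
apply: leeD => //; apply: integral_ge0_mono => // x Dx.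
rewrite ge_max f0// andbT leeBlDr// addeC.
exact: le_trans (kF _ Dx) (Fgf _ Dx).
Qed.

End lower_integral.

(** * Explicit integrals and series *)

Section explicit_integrals.
Variable R : realType.
Local Notation mu := (@lebesgue_measure R).

(** [f] may blow up at both ends, so the fundamental theorem of calculus is applied on compact
    subintervals exhausting the unit interval, followed by monotone convergence. *)
Lemma integral_itv01_le (f F : R -> R) (c : R) :
  (forall x : R, 0 < x < 1 -> is_derive x 1 F (f x)) ->
  (forall x : R, 0 < x < 1 -> {for x, continuous f}) ->
  (forall x : R, 0 < x < 1 -> 0 <= f x) ->
  (forall x : R, 0 < x < 1 -> 0 <= F x <= c) ->
  (\int[mu]_(x in `]0%R, 1%R[) (f x)%:E <= c%:E)%E.
Proof.
move=> dF cf f0 Fc.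
(* The shift by three keeps [a n] below 1/2, so that [[a n, 1 - a n]] is nondegenerate. *)
pose a (n : nat) : R := n.+3%:R^-1.
have a0 n : 0 < a n by rewrite invr_gt0.
have a12 n : a n < 2^-1.
  by rewrite ltf_pV2 ?posrE// ltr_nat.
have aS n m : (n <= m)%N -> a m <= a n.
  by move=> nm; rewrite lef_pV2 ?posrE// ler_nat.
pose D n : set R := `[a n, 1 - a n]%classic.
have D01 n x : D n x -> 0 < x < 1.
  rewrite /D/= in_itv/= => /andP[ax xa]; rewrite (lt_le_trans (a0 n) ax)/=.
  by apply: le_lt_trans xa _; rewrite ltrBlDr ltrDl.
have bigD : `]0%R, 1%R[%classic = \bigcup_i D i.
  apply/seteqP; split => [x|x [i _]]; last first.
    by move/D01; rewrite /= in_itv.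
  rewrite /= in_itv/= => /andP[x0 x1].
  have m0 : 0 < Num.min x (1 - x) by rewrite lt_min x0 subr_gt0 x1.
  pose k := Num.truncn ((Num.min x (1 - x))^-1).
  exists k => //=; rewrite /D/= in_itv/= lerBrDr -lerBrDl.
  have : a k <= Num.min x (1 - x).
    rewrite -[leRHS]invrK lef_pV2 ?posrE ?invr_gt0//.
    rewrite ltW// (lt_le_trans (truncnS_gt _))// ler_nat.
    by rewrite ltnW// ltnW.
  by rewrite le_min => /andP[-> ->].
have cD n : {within D n, continuous f}.
  apply: continuous_in_subspaceT => x; rewrite inE => /D01; exact: cf.
rewrite bigD; apply: cvge_le; last first.
  apply: ge0_nondecreasing_set_cvg_integral.
  - move=> n m nm; rewrite subsetEset => x; rewrite /D/= !in_itv/=.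
    have := aS _ _ nm; move: (a n) (a m) => u v uv /andP[ux xu].
    by apply/andP; split; lra.
  - by move=> i; exact: measurable_itv.
  - move=> i; apply/measurable_EFinP; apply: subspace_continuous_measurable_fun.
      exact: measurable_itv.
    exact: cD.
  - by move=> i x /D01 x01; rewrite lee_fin f0.
apply: nearW => n /=.
have ab : a n < 1 - a n by have := a12 n; move: (a n) => u; lra.
have an1 : 0 < a n < 1 by rewrite a0/=; have := a12 n; lra.
have bn1 : 0 < 1 - a n < 1 by move: an1; lra.
have cF x : 0 < x < 1 -> {for x, continuous F}.
  move=> /dF [+ _] => /derivable1_diffP; exact: differentiable_continuous.
rewrite (_ : (\int[mu]_(x in D n) (f x)%:E = (F (1 - a n))%:E - (F (a n))%:E)%E).
  rewrite -EFinB lee_fin.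
  by have /andP[+ _] := Fc _ an1; have /andP[_ +] := Fc _ bn1; lra.
apply: continuous_FTC2 => //.
- exact: cD.
- split.
  + move=> x; rewrite in_itv/= => /andP[xa xb].
    by have /dF[] : 0 < x < 1 by move: an1; lra.
  + by apply: cvg_at_right_filter; exact: cF.
  + by apply: cvg_at_left_filter; exact: cF.
- move=> x; rewrite in_itv/= => /andP[xa xb].
  have /dF[_ ] : 0 < x < 1 by move: an1; lra.
  by rewrite derive1E => ->.
- exact: eventually_filter.
Qed.

Lemma integral_powR01_le (b : R) : 0 < b ->
  (\int[mu]_(p in `]0%R, 1%R[) (p `^ (b - 1))%:E <= (b^-1)%:E)%E.
Proof.
move=> b0; apply: (@integral_itv01_le (fun p => p `^ (b - 1))
  (fun x => b^-1 * x `^ b)).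
- move=> x /andP[x0 x1]; have dx := is_derive1_powR b x0.
  apply: is_derive_eq; rewrite /GRing.scale/= mulrA mulVf ?gt_eqF// mul1r.
  by [].
- move=> x /andP[x0 x1]; have [dx _] := is_derive1_powR (b - 1) x0.
  by apply: differentiable_continuous; exact/derivable1_diffP.
- by move=> x _; exact: powR_ge0.
- move=> x /andP[x0 x1]; rewrite mulr_ge0 ?powR_ge0 ?invr_ge0 ?(ltW b0)//=.
  rewrite -[leRHS]mulr1 ler_pM2l ?invr_gt0//.
  have -> : (1 : R) = 1 `^ b by rewrite powR1.
  by rewrite ge0_ler_powR ?nnegrE// ltW.
Qed.

(** The antiderivative is shifted by the constant [b^-1] so that it takes values between 0 and
    [b^-1]. *)
Lemma integral_powR01_onem_le (b : R) : 0 < b ->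
  (\int[mu]_(p in `]0%R, 1%R[) ((1 - p) `^ (b - 1))%:E <= (b^-1)%:E)%E.
Proof.
move=> b0.
apply: (@integral_itv01_le (fun p => (1 - p) `^ (b - 1))
  (fun x => b^-1 - b^-1 * (1 - x) `^ b)).
- move=> x /andP[x0 x1].
  have x1' : 0 < 1 - x by rewrite subr_gt0.
  have dp := is_derive1_powR b x1'.
  have d1 : is_derive x (1 : R) (fun y : R => 1 - y) (-1).
    by apply: is_derive_eq; rewrite mulrN1 add0r.
  have dc := @is_derive1_comp R _ (fun y : R => 1 - y) x _ _ dp d1.
  have -> : (fun x : R => b^-1 - b^-1 * (1 - x) `^ b) =
    (fun x : R => b^-1 - b^-1 * ((@powR R ^~ b) \o (fun y : R => 1 - y)) x) by [].
  apply: is_derive_eq; rewrite /GRing.scale/=.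
  by move: ((1 - x) `^ (b - 1)) => u; field; rewrite gt_eqF.
- move=> x /andP[x0 x1].
  have x1' : 0 < 1 - x by rewrite subr_gt0.
  have dp := is_derive1_powR (b - 1) x1'.
  have d1 : is_derive x (1 : R) (fun y : R => 1 - y) (-1).
    by apply: is_derive_eq; rewrite mulrN1 add0r.
  have [dc _] := @is_derive1_comp R _ (fun y : R => 1 - y) x _ _ dp d1.
  have : {for x, continuous ((@powR R ^~ (b - 1)) \o (fun y : R => 1 - y))}.
    by apply: differentiable_continuous; exact/derivable1_diffP.
  exact.
- by move=> x _; exact: powR_ge0.
- move=> x /andP[x0 x1].
  have x1' : 0 < 1 - x by rewrite subr_gt0.
  rewrite subr_ge0 gerBl mulr_ge0 ?powR_ge0 ?invr_ge0 ?(ltW b0)// andbT.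
  rewrite -[leRHS]mulr1 ler_pM2l ?invr_gt0//.
  have one : (1 : R) `^ b = 1 by rewrite powR1.
  by rewrite -[leRHS]one ge0_ler_powR ?nnegrE ?gerBl ?ltW.
Qed.

Lemma integral_affine01_le (A B : R) : 0 <= A -> 0 <= B ->
  (\int[mu]_(p in `]0%R, 1%R[) (A + B * p)%:E <= (A + B / 2)%:E)%E.
Proof.
move=> A0 B0; apply: (@integral_itv01_le (fun p => A + B * p)
  (fun x => A * x + B / 2 * x ^+ 2)).
- move=> x /andP[x0 x1]; apply: is_derive_eq; rewrite /GRing.scale/=; lra.
- move=> x _; apply: differentiable_continuous; exact/derivable1_diffP.
- by move=> x /andP[x0 x1]; rewrite addr_ge0// mulr_ge0// ltW.
- move=> x /andP[x0 x1].
  have x2 : 0 <= x ^+ 2 <= 1 by rewrite sqr_ge0 expr_le1// ltW.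
  have B2 : 0 <= B / 2 by rewrite divr_ge0.
  move: (B / 2) B2 (x ^+ 2) x2 => b b0 y /andP[y0 y1].
  have x0' := ltW x0; have x1' := ltW x1.
  rewrite addr_ge0 ?mulr_ge0//= lerD//.
    by rewrite -[leRHS]mulr1 ler_wpM2l.
  by rewrite -[leRHS]mulr1 ler_wpM2l.
Qed.

Lemma integral_cst01 (c : \bar R) : (\int[mu]_(p in `]0%R, 1%R[) c = c)%E.
Proof.
by rewrite integral_cst//= lebesgue_measure_itv/= lte01 sube0 mule1.
Qed.

Lemma expdens_ge0 (T x : R) : 0 < T -> 0 <= expdens T x.
Proof. by move=> T0; rewrite mulr_ge0 ?expR_ge0// invr_ge0 ltW. Qed.

Lemma measurable_expdens (T : R) (D : set R) : measurable_fun D (expdens T).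
Proof.
apply: measurable_funTS; apply: measurable_funM => //.
apply: measurableT_comp => //; apply: measurableT_comp => //.
by apply: measurable_funM.
Qed.

(** On the half-line the density is the exponential one of rate [T^-1], whose integral over the
    whole line is 1. *)
Lemma integral_expdens_le1 (T : R) : 0 < T ->
  (\int[mu]_(x in `]0%R, +oo[) (expdens T x)%:E <= 1)%E.
Proof.
move=> T0; have Ti : 0 < T^-1 by rewrite invr_gt0.
rewrite -(integral_exponential_pdf Ti).
have -> : (\int[mu]_(x in `]0%R, +oo[) (expdens T x)%:E =
           \int[mu]_(x in `]0%R, +oo[) (exponential_pdf T^-1 x)%:E)%E.
  apply: eq_integral => x; rewrite inE/= in_itv/= andbT => x0.
  by rewrite exponential_pdfE ?ltW// /expdens mulNr [x / T]mulrC.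
apply: ge0_subset_integral => //=.
- by apply/measurable_EFinP; exact: measurable_exponential_pdf.
- by move=> x _; rewrite lee_fin exponential_pdf_ge0// ltW.
Qed.

(* From [x / (2T) <= exp (x / (2T))]; it bounds the mean of the exponential law
   without computing it. *)
Lemma expdens_mulr_le (T x : R) : 0 < T ->
  x * expdens T x <= 4 * T * expdens (2 * T) x.
Proof.
move=> T0; rewrite /expdens.
set y := x / (2 * T).
have xE : x = 2 * T * y by rewrite /y; field; rewrite gt_eqF.
have -> : x / T = y + y by rewrite /y; field; rewrite gt_eqF.
rewrite opprD expRD {1}xE.
have -> : 2 * T * y * (T^-1 * (expR (- y) * expR (- y))) =
  2 * expR (- y) * (y * expR (- y)) by field; rewrite gt_eqF.
have -> : 4 * T * ((2 * T)^-1 * expR (- y)) = 2 * expR (- y).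
  by field; rewrite gt_eqF.
rewrite -[leRHS]mulr1 ler_pM2l ?mulr_gt0 ?expR_gt0// expRN.
rewrite ler_pdivrMr ?expR_gt0// mul1r (le_trans _ (expR_ge1Dx y))//.
by rewrite lerDr.
Qed.

Lemma integral_middle_half (c : R) : 0 <= c ->
  (\int[mu]_(p in `]0%R, 1%R[) (c * \1_(`[4^-1, 3 / 4]) p)%:E = (c / 2)%:E)%E.
Proof.
move=> c0; under eq_integral do rewrite EFinM.
rewrite ge0_integralZl//=; last first.
  by apply/measurable_EFinP; apply: measurable_funTS; exact: measurable_indic.
rewrite integral_indic//= setIidl; last first.
  by move=> p /=; rewrite !in_itv/= => /andP[p0 p1]; apply/andP; split; lra.
rewrite lebesgue_measure_itv/= lte_fin ifT; last lra.
by rewrite -EFinB -EFinM; congr (_ * _)%:E; lra.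
Qed.

Definition poisson_weight (x : R) (m : nat) : R := expR (- x) * x ^+ m / m`!%:R.

Lemma poisson_weight_ge0 (x : R) m : 0 <= x -> 0 <= poisson_weight x m.
Proof. by move=> x0; rewrite mulr_ge0// mulr_ge0 ?expR_ge0// exprn_ge0. Qed.

Lemma poisson_weight_gt0 (x : R) m : 0 < x -> 0 < poisson_weight x m.
Proof.
move=> x0; rewrite mulr_gt0 ?invr_gt0 ?ltr0n ?fact_gt0//.
by rewrite mulr_gt0 ?expR_gt0// exprn_gt0.
Qed.

(** The generating function of the Poisson law: [c = 1] gives the total mass, [c = 2] dominates the
    mean, and a general [c] handles geometric growth in the number of steps. *)
Lemma poisson_series (x c : R) : 0 <= x -> 0 <= c ->
  (\sum_(m <oo) (poisson_weight x m * c ^+ m)%:E = (expR (- x + x * c))%:E)%E.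
Proof.
move=> x0 c0.
under eq_eseriesr => m _.
  rewrite (_ : poisson_weight x m * c ^+ m =
    expR (- x) * ((x * c) ^+ m / m`!%:R)); last first.
    by rewrite /poisson_weight exprMn; ring.
  rewrite EFinM; over.
rewrite /= nneseriesZl/=; last first.
  by move=> m _; rewrite lee_fin divr_ge0// exprn_ge0// mulr_ge0.
rewrite expRD EFinM; congr (_ * _)%E; rewrite expRE -EFin_lim; last first.
  rewrite /pseries/=; under eq_fun do rewrite mulrC.
  exact: is_cvg_series_exp_coeff.
apply/congr_lim/funext => m/=; rewrite /pseries/= /series/= -sumEFin//.
by under eq_bigr do rewrite mulrC.
Qed.

End explicit_integrals.

(** * The uniformised kernel and the semigroup *)

Section clocks.
Context {R : realType}.
Variables (N : nat) (TL TR K : R).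
Hypotheses (N1 : (1 <= N)%N) (TL0 : 0 < TL) (TR0 : 0 < TR) (K0 : 0 < K).
Local Notation mu := (@lebesgue_measure R).
Local Notation n := N.-1.
Local Notation pos := (posstate N).
Local Notation ge0 f := (forall y, posstate N y -> (0 <= f y)%E).
Implicit Types (E : state R) (f g : state R -> \bar R).

Let nN : (n < N)%N. Proof. by rewrite ltn_predL. Qed.

Let nSN i : (i < n)%N -> (i.+1 < N)%N. Proof. by rewrite ltn_predRL. Qed.

(** * Positivity and total energy of updated states *)

Lemma posstate_upd1 E i v : pos E -> 0 < v -> pos (upd1 E i v).
Proof. by move=> pE v0 j jN; rewrite /upd1; case: eqP => // _; exact: pE. Qed.

Lemma posstate_upd2 E i p : pos E -> (i < n)%N -> 0 < p < 1 -> pos (upd2 E i p).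
Proof.
move=> pE i_n /andP[p0 p1] j jN; have iN := nSN i_n.
have s0 : 0 < E i + E i.+1 by rewrite addr_gt0// pE// ltnW.
by rewrite /upd2; case: eqP => _; [|case: eqP => _; last exact: pE];
  rewrite mulr_gt0// subr_gt0.
Qed.

Lemma W_upd1 E i v : (i < N)%N -> W N (upd1 E i v) = W N E - E i + v.
Proof.
move=> iN; rewrite /W (bigD1 (Ordinal iN))//= [in RHS](bigD1 (Ordinal iN))//=.
rewrite /upd1 eqxx [E i + _]addrC addrK addrC; congr (_ + v).
apply: eq_bigr => j ji; case: eqP => // ei.
by move: ji; rewrite -val_eqE/= ei eqxx.
Qed.

Lemma W_upd2 E i p : (i.+1 < N)%N -> W N (upd2 E i p) = W N E.
Proof.
move=> iN; pose s := E i + E i.+1.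
(* An exchange is two successive single-site updates, whose energy changes cancel. *)
have -> : upd2 E i p = upd1 (upd1 E i.+1 ((1 - p) * s)) i (p * s).
  by apply/funext => j; rewrite /upd2 /upd1; case: eqP => // _; case: eqP.
rewrite !W_upd1//; last exact: ltnW.
by rewrite /upd1 ltn_eqF// /s; ring.
Qed.

Lemma le_W E i : pos E -> (i < N)%N -> E i <= W N E.
Proof.
move=> pE iN; rewrite /W (bigD1 (Ordinal iN))//= lerDl sumr_ge0// => j _.
by rewrite ltW// pE.
Qed.

Lemma W_ge0 E : pos E -> 0 <= W N E.
Proof. by move=> pE; rewrite sumr_ge0// => j _; rewrite ltW// pE. Qed.

(** * Averages over the effect of a single clock *)

Definition avg2 i f E : \bar R :=
  (\int[mu]_(p in `]0%R, 1%R[) f (upd2 E i p))%E.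

Definition avg1 (T : R) i f E : \bar R :=
  (\int[mu]_(p in `]0%R, 1%R[) \int[mu]_(x in `]0%R, +oo[)
     ((expdens T x)%:E * f (upd1 E i (p * (E i + x)%R)%R)))%E.

(* Clocks 0 .. n-1 are the exchanges, n and n+1 the two heat baths, and n+2 is
   the fictitious clock of the uniformisation. *)
Definition avg k f E : \bar R :=
  if (k < n)%N then avg2 k f E
  else if k == n then avg1 TL 0 f E
  else if k == n.+1 then avg1 TR n f E
  else f E.

Definition clock_rate k E : R :=
  if (k < n)%N then rate K (E k) (E k.+1)
  else if k == n then rate K TL (E 0%N)
  else if k == n.+1 then rate K (E n) TR
  else lam N K - totrate N TL TR K E.

Definition clock_prob k E : R := (lam N K)^-1 * clock_rate k E.

Let lam0 : 0 < lam N K.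
Proof. by rewrite mulr_gt0. Qed.

Lemma rate_ge0 a b : 0 <= rate K a b.
Proof. by rewrite le_min sqrtr_ge0 ltW. Qed.

Lemma rate_le a b : rate K a b <= K.
Proof. by rewrite ge_min lexx. Qed.

Lemma totrate_le E : totrate N TL TR K E <= lam N K.
Proof.
rewrite /totrate.
apply: (@le_trans _ _ (\sum_(i < n) K + K + K)).
  by rewrite !lerD ?rate_le// ler_sum// => i _; exact: rate_le.
rewrite sumr_const card_ord /lam -{2}(prednK N1) -!natr1 !mulrDl !mul1r.
by rewrite mulr_natl.
Qed.

Lemma clock_rate_ge0 k E : 0 <= clock_rate k E.
Proof.
rewrite /clock_rate; do 3 (case: ifP => _; first exact: rate_ge0).
by rewrite subr_ge0 totrate_le.
Qed.

Lemma clock_prob_ge0 k E : 0 <= clock_prob k E.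
Proof. by rewrite mulr_ge0 ?clock_rate_ge0// invr_ge0 ltW. Qed.

Lemma clock_sum (V : nmodType) (a : nat -> V) :
  \sum_(k < n.+3) a k = \sum_(k < n) a k + a n + a n.+1 + a n.+2.
Proof. by rewrite !big_ord_recr. Qed.

(** The fictitious clock carries exactly the rate missing from [lam N K]. *)
Lemma sum_clock_prob E : \sum_(k < n.+3) clock_prob k E = 1.
Proof.
rewrite /clock_prob -mulr_sumr (clock_sum (fun k => clock_rate k E)).
rewrite [in X in _ * X]/clock_rate !ltnn !eqxx ltnNge leqnSn/= (gtn_eqF (ltnSn n)).
rewrite ltnNge (leq_trans (leqnSn n))//= !gtn_eqF//.
rewrite (eq_bigr (fun i : 'I_n => rate K (E i) (E i.+1))); last first.
  by move=> i _; rewrite ltn_ord.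
by rewrite -/(totrate N TL TR K E) addrC subrK mulVf// gt_eqF.
Qed.

Lemma avg_ge0 k f E : ge0 f -> pos E -> (0 <= avg k f E)%E.
Proof.
move=> f0 pE; rewrite /avg; case: ifPn => kn.
  apply: integral_ge0 => p /=; rewrite in_itv/= => p01.
  by apply: f0; exact: posstate_upd2.
have avg1_ge0 T i : 0 < T -> (i < N)%N -> (0 <= avg1 T i f E)%E.
  move=> T0 iN; apply: integral_ge0 => p /=; rewrite in_itv/= => /andP[p0 p1].
  apply: integral_ge0 => x /=; rewrite in_itv/= andbT => x0.
  rewrite mule_ge0 ?lee_fin ?expdens_ge0// f0//.
  by apply: posstate_upd1 => //; rewrite mulr_gt0// addr_gt0// pE.
by do 2 (case: ifPn => _; first exact: avg1_ge0); exact: f0.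
Qed.

(** With the kernel written as a convex combination of clock averages, every estimate below can be
    made clock by clock. *)
Lemma QopE f E : ge0 f -> pos E ->
  Qop N TL TR K f E = (\sum_(k < n.+3) (clock_prob k E)%:E * avg k f E)%E.
Proof.
move=> f0 pE.
transitivity ((lam N K)^-1%:E *
    \sum_(k < n.+3) (clock_rate k E)%:E * avg k f E)%E; last first.
  rewrite ge0_sume_distrr; last first.
    by move=> k _; rewrite mule_ge0 ?avg_ge0// lee_fin clock_rate_ge0.
  by apply: eq_bigr => k _; rewrite muleA.
rewrite /Qop (clock_sum (fun k => (clock_rate k E)%:E * avg k f E)%E).
rewrite {2 3 4}/clock_rate {2 3 4}/avg.
rewrite !ltnn !eqxx [(n.+1 < n)%N]ltnNge leqnSn/= (gtn_eqF (ltnSn n)).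
rewrite ltnNge (leq_trans (leqnSn n))//= !gtn_eqF//.
congr (_ * (_ + _ + _ + _))%E; apply: eq_bigr => i _.
by rewrite /clock_rate /avg ltn_ord.
Qed.

Lemma avg_le k f g E : ge0 f -> (forall y, pos y -> (f y <= g y)%E) -> pos E ->
  (avg k f E <= avg k g E)%E.
Proof.
move=> f0 fg pE; rewrite /avg; case: ifPn => kn.
  apply: integral_ge0_mono => p /=; rewrite in_itv/= => p01.
    by apply: f0; exact: posstate_upd2.
  by apply: fg; exact: posstate_upd2.
have avg1_le T i : 0 < T -> (i < N)%N -> (avg1 T i f E <= avg1 T i g E)%E.
  move=> T0 iN.
  have pu (p x : R) : 0 < p -> 0 < x -> pos (upd1 E i (p * (E i + x))).
    by move=> p0 x0; apply: posstate_upd1 => //; rewrite mulr_gt0// addr_gt0// pE.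
  have i0 p x : 0 < p -> 0 < x ->
      (0 <= (expdens T x)%:E * f (upd1 E i (p * (E i + x))))%E.
    by move=> p0 x0; rewrite mule_ge0 ?lee_fin ?expdens_ge0// f0//; exact: pu.
  apply: integral_ge0_mono => p /=; rewrite in_itv/= => /andP[p0 p1].
    apply: integral_ge0 => x /=; rewrite in_itv/= andbT; exact: i0.
  apply: integral_ge0_mono => x /=; rewrite in_itv/= andbT => x0; first exact: i0.
  by rewrite lee_wpmul2l ?lee_fin ?expdens_ge0// fg//; exact: pu.
by do 2 (case: ifPn => _; first exact: avg1_le); exact: fg.
Qed.

Lemma avg_superadd k f g E : ge0 f -> ge0 g -> pos E ->
  (avg k f E + avg k g E <= avg k (fun y => f y + g y) E)%E.
Proof.
move=> f0 g0 pE; rewrite /avg; case: ifPn => kn.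
  by apply: integral_superadd => //= p; rewrite in_itv/= => p01;
    [apply: f0|apply: g0]; exact: posstate_upd2.
have avg1_superadd T i : 0 < T -> (i < N)%N ->
    (avg1 T i f E + avg1 T i g E <= avg1 T i (fun y => f y + g y) E)%E.
  move=> T0 iN.
  have pu (p x : R) : 0 < p -> 0 < x -> pos (upd1 E i (p * (E i + x))).
    by move=> p0 x0; apply: posstate_upd1 => //; rewrite mulr_gt0// addr_gt0// pE.
  have i0 h p x : ge0 h -> 0 < p -> 0 < x ->
      (0 <= (expdens T x)%:E * h (upd1 E i (p * (E i + x))))%E.
    by move=> h0 p0 x0; rewrite mule_ge0 ?lee_fin ?expdens_ge0// h0//; exact: pu.
  have j0 h p : ge0 h -> `]0%R, 1%R[%classic p ->
      (0 <= \int[mu]_(x in `]0%R, +oo[)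
              ((expdens T x)%:E * h (upd1 E i (p * (E i + x)%R)%R)))%E.
    move=> h0 /=; rewrite in_itv/= => /andP[p0 p1].
    by apply: integral_ge0 => x /=; rewrite in_itv/= andbT; exact: i0.
  apply: le_trans.
    by apply: integral_superadd => // p; exact: j0.
  apply: integral_ge0_mono => p p01; first by rewrite adde_ge0 ?j0.
  move: p01; rewrite /= in_itv/= => /andP[p0 p1].
  apply: le_trans.
    by apply: integral_superadd => //= x; rewrite in_itv/= andbT; exact: i0.
  apply: integral_ge0_mono => x /=; rewrite in_itv/= andbT => x0.
    by rewrite adde_ge0 ?i0.
  by rewrite ge0_muleDr// ?f0 ?g0//; exact: pu.
by do 2 (case: ifPn => _; first exact: avg1_superadd).
Qed.

Lemma avg_scale_le k f (c : R) E : 0 < c -> ge0 f -> pos E ->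
  (avg k (fun y => c%:E * f y) E <= c%:E * avg k f E)%E.
Proof.
move=> c0 f0 pE; rewrite /avg; case: ifPn => kn.
  apply: integral_scale_le => //= p; rewrite in_itv/= => p01.
  by apply: f0; exact: posstate_upd2.
have avg1_scale T i : 0 < T -> (i < N)%N ->
    (avg1 T i (fun y => c%:E * f y) E <= c%:E * avg1 T i f E)%E.
  move=> T0 iN.
  have pu (p x : R) : 0 < p -> 0 < x -> pos (upd1 E i (p * (E i + x))).
    by move=> p0 x0; apply: posstate_upd1 => //; rewrite mulr_gt0// addr_gt0// pE.
  have i0 p x : 0 < p -> 0 < x ->
      (0 <= (expdens T x)%:E * f (upd1 E i (p * (E i + x))))%E.
    by move=> p0 x0; rewrite mule_ge0 ?lee_fin ?expdens_ge0// f0//; exact: pu.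
  have j0 p : `]0%R, 1%R[%classic p ->
      (0 <= \int[mu]_(x in `]0%R, +oo[)
              ((expdens T x)%:E * f (upd1 E i (p * (E i + x)%R)%R)))%E.
    rewrite /= in_itv/= => /andP[p0 p1].
    by apply: integral_ge0 => x /=; rewrite in_itv/= andbT; exact: i0.
  apply: le_trans; last by apply: integral_scale_le => // p; exact: j0.
  apply: integral_ge0_mono => p /=; rewrite in_itv/= => /andP[p0 p1].
    apply: integral_ge0 => x /=; rewrite in_itv/= andbT => x0.
    by rewrite muleCA mule_ge0 ?i0// lee_fin ltW.
  under eq_integral do rewrite muleCA.
  apply: integral_scale_le => // x /=; rewrite in_itv/= andbT; exact: i0.
by do 2 (case: ifPn => _; first exact: avg1_scale).
Qed.

(** * Growth of the total energy at one clock *)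

(** One-sided subadditivity is used twice, over [x] and then over [p]; the explicit energy is the
    measurable summand, while [f] may be nonmeasurable. The mean 1/2 of [p] halves both [E i] and
    the crude bound [4 * T] on the mean of [x]. *)
Lemma avg1_W_le (T c : R) i F f E : 0 < T -> (i < N)%N -> 0 <= c ->
  ge0 F -> ge0 f -> pos E ->
  (forall y, pos y -> (F y <= (W N y + c)%:E + f y)%E) ->
  (avg1 T i F E <= (W N E + c - E i / 2 + 2 * T)%:E + avg1 T i f E)%E.
Proof.
move=> T0 iN c0 F0 f0 pE Ff.
have Ei0 : 0 <= E i by rewrite ltW// pE.
(* Energy away from site [i], plus [c]: the update turns [W + c] into [w + p * (E i + x)]. *)
pose w := W N E - E i + c.
have w0 : 0 <= w by rewrite addr_ge0// subr_ge0 le_W.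
have pu (p x : R) : 0 < p -> 0 < x -> pos (upd1 E i (p * (E i + x))).
  by move=> p0 x0; apply: posstate_upd1 => //; rewrite mulr_gt0// addr_gt0// pE.
have i0 h p x : ge0 h -> 0 < p -> 0 < x ->
    (0 <= (expdens T x)%:E * h (upd1 E i (p * (E i + x))))%E.
  by move=> h0 p0 x0; rewrite mule_ge0 ?lee_fin ?expdens_ge0// h0//; exact: pu.
have j0 h p : ge0 h -> `]0%R, 1%R[%classic p ->
    (0 <= \int[mu]_(x in `]0%R, +oo[)
            ((expdens T x)%:E * h (upd1 E i (p * (E i + x)%R)%R)))%E.
  move=> h0 /=; rewrite in_itv/= => /andP[p0 p1].
  by apply: integral_ge0 => x /=; rewrite in_itv/= andbT; exact: i0.
have B0 : 0 <= E i + 4 * T by rewrite addr_ge0// mulr_ge0// ltW.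
apply: (@integral_subadd _ _ _ mu `]0%R, 1%R[%classic (measurable_itv _) _ _
  (fun p => w + (E i + 4 * T) * p)) => //.
- by move=> p; exact: j0.
- move=> p /=; rewrite in_itv/= => /andP[p0 p1].
  by rewrite addr_ge0// mulr_ge0// ltW.
- by apply: measurable_funD => //; apply: measurable_funM.
- by move=> p; exact: j0.
- move=> p /=; rewrite in_itv/= => /andP[p0 p1].
  have T20 : 0 < 2 * T by rewrite mulr_gt0.
  have p0' := ltW p0.
  have T0' := ltW T0.
  (* The term in [x * expdens T x] is replaced by its majorant from [expdens_mulr_le]. *)
  apply: (@integral_subadd _ _ _ mu `]0%R, +oo[%classic (measurable_itv _) _ _
    (fun x => (w + p * E i) * expdens T x + p * (4 * T) * expdens (2 * T) x)) => //.
  + by move=> x /=; rewrite in_itv/= andbT; exact: i0.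
  + move=> x _; rewrite addr_ge0// mulr_ge0 ?expdens_ge0//.
      by rewrite addr_ge0// mulr_ge0.
    by rewrite !mulr_ge0.
  + by apply: measurable_funD; apply: measurable_funM => //;
      exact: measurable_expdens.
  + by move=> x /=; rewrite in_itv/= andbT; exact: i0.
  + move=> x /=; rewrite in_itv/= andbT => x0.
    have pux := pu _ _ p0 x0.
    apply: (@le_trans _ _ ((expdens T x)%:E *
      ((W N (upd1 E i (p * (E i + x))) + c)%:E + f (upd1 E i (p * (E i + x)))))%E).
      by rewrite lee_wpmul2l ?lee_fin ?expdens_ge0// Ff.
    rewrite ge0_muleDr ?f0//; last by rewrite lee_fin addr_ge0// W_ge0.
    rewrite leeD2r// -EFinM lee_fin W_upd1//.
    have := expdens_mulr_le x T0.
    rewrite /w; move: (expdens T x) (expdens (2 * T) x) => u v uv.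
    have := ler_wpM2l p0' uv; lra.
  + have A0 : 0 <= w + p * E i by rewrite addr_ge0// mulr_ge0.
    have C0 : 0 <= p * (4 * T) by rewrite !mulr_ge0.
    under eq_integral do rewrite EFinD.
    rewrite ge0_integralD//=; last 4 first.
    * by move=> x _; rewrite lee_fin mulr_ge0 ?expdens_ge0.
    * by apply/measurable_EFinP; apply: measurable_funM => //; exact: measurable_expdens.
    * by move=> x _; rewrite lee_fin mulr_ge0 ?expdens_ge0.
    * by apply/measurable_EFinP; apply: measurable_funM => //; exact: measurable_expdens.
    under eq_integral do rewrite EFinM.
    under [X in (_ + X)%E]eq_integral do rewrite EFinM.
    rewrite !ge0_integralZl//=; last 4 first.
    * by apply/measurable_EFinP; exact: measurable_expdens.
    * by move=> x _; rewrite lee_fin expdens_ge0.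
    * by apply/measurable_EFinP; exact: measurable_expdens.
    * by move=> x _; rewrite lee_fin expdens_ge0.
    have -> : w + (E i + 4 * T) * p = (w + p * E i) * 1 + p * (4 * T) * 1 by ring.
    by rewrite [leRHS]EFinD leeD// [leRHS]EFinM lee_wpmul2l ?lee_fin//;
      exact: integral_expdens_le1.
- by apply: le_trans (integral_affine01_le w0 B0) _; rewrite lee_fin /w; lra.
Qed.

(* The loss [E n / 2] at the right bath is not needed and is discarded. *)
Definition bath_gain k E : R :=
  if k == n then 2 * TL - E 0%N / 2 else if k == n.+1 then 2 * TR else 0.

(** The comparison of [F] with [W + c + f] reproduces itself, only the constant changing, so it can
    be iterated without ever splitting the integral of two nonmeasurable summands. *)
Lemma avg_W_le k F f (c : R) E : 0 <= c -> ge0 F -> ge0 f -> pos E ->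
  (forall y, pos y -> (F y <= (W N y + c)%:E + f y)%E) ->
  (avg k F E <= (W N E + c + bath_gain k E)%:E + avg k f E)%E.
Proof.
move=> c0 F0 f0 pE Ff; rewrite /avg /bath_gain; case: ifPn => kn.
  rewrite ltn_eqF// ltn_eqF ?leqW// addr0.
  apply: (@integral_subadd _ _ _ mu `]0%R, 1%R[%classic (measurable_itv _) _ _
    (fun=> W N E + c)) => //.
  - by move=> p /=; rewrite in_itv/= => p01; apply: f0; exact: posstate_upd2.
  - by move=> p _; rewrite addr_ge0// W_ge0.
  - by move=> p /=; rewrite in_itv/= => p01; apply: F0; exact: posstate_upd2.
  - move=> p /=; rewrite in_itv/= => p01.
    by rewrite -(W_upd2 E p (nSN kn)); apply: Ff; exact: posstate_upd2.
  - by rewrite integral_cst01.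
case: ifPn => _.
  apply: le_trans (avg1_W_le TL0 N1 c0 F0 f0 pE Ff) _.
  by rewrite leeD2r// lee_fin; lra.
case: ifPn => _; last by rewrite addr0 Ff.
apply: le_trans (avg1_W_le TR0 nN c0 F0 f0 pE Ff) _.
rewrite leeD2r// lee_fin; have := pE _ nN; lra.
Qed.

(** * Operators inheriting the calculus of lower integrals *)

(** What remains of linearity for a lower integral. The properties are stable under composition,
    hence pass from [Qop] to its iterates, to [Pt], and to [Pt] killed on a set. *)
Record lower_linear (A : (state R -> \bar R) -> state R -> \bar R) : Prop := {
  ll_ge0 : forall f, ge0 f -> ge0 (A f);
  ll_le : forall f g, ge0 f -> (forall y, pos y -> (f y <= g y)%E) ->
    forall E, pos E -> (A f E <= A g E)%E;
  ll_superadd : forall f g, ge0 f -> ge0 g ->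
    forall E, pos E -> (A f E + A g E <= A (fun y => f y + g y) E)%E;
  ll_scale_le : forall (c : R) f, 0 < c -> ge0 f ->
    forall E, pos E -> (A (fun y => c%:E * f y) E <= c%:E * A f E)%E }.

Lemma lower_linear_comp A B : lower_linear A -> lower_linear B ->
  lower_linear (fun f => A (B f)).
Proof.
move=> lA lB; split.
- by move=> f f0; apply: (ll_ge0 lA); exact: (ll_ge0 lB).
- move=> f g f0 fg E pE; apply: (ll_le lA) => //; first exact: (ll_ge0 lB).
  by move=> y py; exact: (ll_le lB).
- move=> f g f0 g0 E pE.
  have Bf := ll_ge0 lB f0; have Bg := ll_ge0 lB g0.
  apply: le_trans (ll_superadd lA Bf Bg pE) _; apply: (ll_le lA) => // y py.
    by rewrite adde_ge0 ?Bf ?Bg.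
  exact: (ll_superadd lB).
- move=> c f c0 f0 E pE; have Bf := ll_ge0 lB f0.
  apply: le_trans _ (ll_scale_le lA c0 Bf pE); apply: (ll_le lA) => // y py.
    apply: (ll_ge0 lB) => // z pz.
    by rewrite mule_ge0 ?f0// lee_fin ltW.
  exact: (ll_scale_le lB).
Qed.

Lemma lower_linear_iter A m : lower_linear A -> lower_linear (iter m A).
Proof.
move=> lA; elim: m => [|m IH]; last exact: (lower_linear_comp lA IH).
by split=> [f f0|f g f0 fg|f g f0 g0 E pE|c f c0 f0 E pE] //=; exact: lexx.
Qed.

(** Killing on [S]; composed with [Pt] it gives the operator iterated in [Phat]. *)
Lemma lower_linear_off (S : set (state R)) :
  lower_linear (fun g y => if `[< S y >] then 0%E else g y).
Proof.
split=> [f f0 y py|f g f0 fg y py|f g f0 g0 y py|c f c0 f0 y py] /=.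
- by case: ifP => // _; exact: f0.
- by case: ifP => // _; exact: fg.
- by case: ifP => //; rewrite adde0.
- by case: ifP => //; rewrite mule0.
Qed.

Local Notation Q := (Qop N TL TR K).
Local Notation prob := clock_prob.

Lemma lower_linear_Qop : lower_linear Q.
Proof.
have prob0 k E : (0 <= (prob k E)%:E)%E by rewrite lee_fin clock_prob_ge0.
split.
- move=> f f0 E pE; rewrite QopE// sume_ge0// => k _.
  by rewrite mule_ge0// avg_ge0.
- move=> f g f0 fg E pE.
  have g0 : ge0 g by move=> y py; exact: le_trans (f0 _ py) (fg _ py).
  by rewrite !QopE// lee_sum// => k _; rewrite lee_wpmul2l// avg_le.
- move=> f g f0 g0 E pE.
  have fg0 : ge0 (fun y => f y + g y)%E by move=> y py; rewrite adde_ge0 ?f0 ?g0.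
  rewrite !QopE// -big_split/= lee_sum// => k _.
  by rewrite -ge0_muleDr ?avg_ge0// lee_wpmul2l// avg_superadd.
- move=> c f c0 f0 E pE.
  have cf0 : ge0 (fun y => c%:E * f y)%E.
    by move=> y py; rewrite mule_ge0 ?f0// lee_fin ltW.
  rewrite !QopE// ge0_sume_distrr; last first.
    by move=> k _; rewrite mule_ge0// avg_ge0.
  by rewrite lee_sum// => k _; rewrite muleCA lee_wpmul2l// avg_scale_le.
Qed.

Lemma Qop_avg_le f (x : R) E : ge0 f -> pos E ->
  (forall k, (avg k f E <= x%:E)%E) -> (Q f E <= x%:E)%E.
Proof.
move=> f0 pE fx; rewrite QopE//.
rewrite -[x]mul1r -(sum_clock_prob E) mulr_suml -sumEFin lee_sum// => k _.
by rewrite [leRHS]EFinM lee_wpmul2l// lee_fin clock_prob_ge0.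
Qed.

Lemma Qop_ge_avg f k E : ge0 f -> pos E -> (k < n.+3)%N ->
  ((prob k E)%:E * avg k f E <= Q f E)%E.
Proof.
move=> f0 pE kn; rewrite QopE// (bigD1 (Ordinal kn))//= leeDl// sume_ge0// => j _.
by rewrite mule_ge0 ?avg_ge0// lee_fin clock_prob_ge0.
Qed.

(** Upper bound for the mean energy gained in one step, since each bath clock has probability at
    most 1. *)
Definition drift : R := 2 * TL + 2 * TR.

(** The clock probabilities sum to 1, so [W + c] is reproduced and only the bath terms remain. The
    loss at the left bath stands on the left side, which avoids subtraction in the extended
    reals. *)
Lemma Qop_W_le F f (c : R) E : 0 <= c -> ge0 F -> ge0 f -> pos E ->
  (forall y, pos y -> (F y <= (W N y + c)%:E + f y)%E) ->
  (Q F E + (prob n E * (E 0%N / 2))%:E <= (W N E + (c + drift))%:E + Q f E)%E.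
Proof.
move=> c0 F0 f0 pE Ff; rewrite !QopE//.
have sumW : \sum_(k < n.+3) prob k E * (W N E + c + bath_gain k E) =
    W N E + c + (prob n E * (2 * TL - E 0%N / 2) + prob n.+1 E * (2 * TR)).
  under eq_bigr do rewrite mulrDr.
  rewrite big_split/= -mulr_suml sum_clock_prob mul1r; congr (_ + _).
  rewrite (clock_sum (fun k => prob k E * bath_gain k E)).
  have e1 : (n.+1 == n) = false by rewrite gtn_eqF.
  have e2 : (n.+2 == n) = false by rewrite gtn_eqF// leqW.
  have e3 : (n.+2 == n.+1) = false by rewrite gtn_eqF.
  rewrite /bath_gain !eqxx e1 e2 e3.
  rewrite mulr0 addr0 big1 ?add0r// => k _.
  by rewrite ltn_eqF// ltn_eqF ?mulr0// leqW.
have le1 k : (k < n.+3)%N -> prob k E <= 1.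
  move=> kn; rewrite -(sum_clock_prob E) (bigD1 (Ordinal kn))//= lerDl.
  by rewrite sumr_ge0// => j _; exact: clock_prob_ge0.
apply: (@le_trans _ _ ((\sum_(k < n.+3) prob k E * (W N E + c + bath_gain k E))%:E
   + \sum_(k < n.+3) (prob k E)%:E * avg k f E
   + (prob n E * (E 0%N / 2))%:E)%E).
  rewrite leeD2r// -sumEFin -big_split/= lee_sum// => k _.
  rewrite [X in (_ <= X + _)%E]EFinM -muleDr// ?fin_num_adde_defr//.
  by rewrite lee_wpmul2l ?lee_fin ?clock_prob_ge0// avg_W_le.
rewrite addeAC -EFinD leeD2r// lee_fin sumW /drift.
have := le1 n (leqW (leqW (ltnSn _))); have := le1 n.+1 (leqW (ltnSn _)).
have := clock_prob_ge0 n E; have := clock_prob_ge0 n.+1 E.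
move: (prob n E) (prob n.+1 E) => u v v0 u0 v1 u1.
have : u * (2 * TL) <= 2 * TL by rewrite ler_piMl// mulr_ge0// ltW.
have : v * (2 * TR) <= 2 * TR by rewrite ler_piMl// mulr_ge0// ltW.
lra.
Qed.

Lemma drift_ge0 : 0 <= drift.
Proof. by rewrite addr_ge0// mulr_ge0// ltW. Qed.

Lemma iter_Qop_W_le m F f E : ge0 F -> ge0 f -> pos E ->
  (forall y, pos y -> (F y <= (W N y)%:E + f y)%E) ->
  (iter m Q F E <= (W N E + m%:R * drift)%:E + iter m Q f E)%E.
Proof.
move=> F0 f0 pE Ff; elim: m E pE => [|m IH] E pE.
  by rewrite mul0r addr0 /= Ff.
have Qm := lower_linear_iter m lower_linear_Qop.
have c0 : 0 <= m%:R * drift by rewrite mulr_ge0 ?drift_ge0.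
have := Qop_W_le c0 (ll_ge0 Qm F0) (ll_ge0 Qm f0) pE IH.
rewrite -[X in (W N E + (_ + X))%R]mul1r -mulrDl natr1; apply: le_trans.
rewrite /= leeDl// lee_fin mulr_ge0 ?clock_prob_ge0//.
by rewrite divr_ge0// ltW// pE.
Qed.

(** * The semigroup over one sampling period *)

Section transition_semigroup.
Variable h : R.
Hypothesis h0 : 0 < h.
Local Notation P := (Pt N TL TR K h).
Local Notation wgt := (poisson_weight (lam N K * h)).

Let x0 : 0 < lam N K * h. Proof. exact: mulr_gt0. Qed.

Let wgt0 m : (0 <= (wgt m)%:E)%E.
Proof. by rewrite lee_fin poisson_weight_ge0// ltW. Qed.

Lemma PtE f E : P f E = (\sum_(m <oo) (wgt m)%:E * iter m Q f E)%E.
Proof. by []. Qed.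

Lemma lower_linear_Pt : lower_linear P.
Proof.
have lQ m := lower_linear_iter m lower_linear_Qop.
have t0 m f E : ge0 f -> pos E -> (0 <= (wgt m)%:E * iter m Q f E)%E.
  by move=> f0 pE; rewrite mule_ge0// (ll_ge0 (lQ m)).
split.
- by move=> f f0 E pE; rewrite PtE nneseries_ge0// => m _ _; exact: t0.
- move=> f g f0 fg E pE; rewrite !PtE; apply: lee_nneseries => m.
    by move=> *; exact: t0.
  by move=> _; rewrite lee_wpmul2l//; exact: (ll_le (lQ m)).
- move=> f g f0 g0 E pE; rewrite !PtE -nneseriesD; last 2 first.
  + by move=> *; exact: t0.
  + by move=> *; exact: t0.
  apply: lee_nneseries => m; first by move=> *; rewrite adde_ge0 ?t0.
  move=> _; rewrite -ge0_muleDr ?(ll_ge0 (lQ m))// lee_wpmul2l//.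
  exact: (ll_superadd (lQ m)).
- move=> c f c0 f0 E pE; rewrite !PtE -nneseriesZl; last by move=> *; exact: t0.
  apply: lee_nneseries => m.
    move=> *; apply: t0 => // y py; rewrite mule_ge0 ?f0// lee_fin ltW//.
  move=> _; rewrite muleCA lee_wpmul2l//; exact: (ll_scale_le (lQ m)).
Qed.

(** The factor is the Poisson mean of [2 ^ m], which dominates the mean number of steps. *)
Definition drift_Pt : R := expR (lam N K * h) * drift.

Lemma drift_Pt_ge0 : 0 <= drift_Pt.
Proof. by rewrite mulr_ge0 ?expR_ge0// drift_ge0. Qed.

(** Poisson average of the estimates for the iterates. [d m] is the energy loss recorded after [m]
    steps; a finite number of these losses is retained, so their total is a real number. *)
Lemma Pt_W_le F f (d : nat -> R) E M : ge0 F -> ge0 f -> pos E ->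
  (forall m, 0 <= d m) ->
  (forall m, (iter m Q F E + (d m)%:E <=
    (W N E + m%:R * drift)%:E + iter m Q f E)%E) ->
  (P F E + (\sum_(0 <= m < M) wgt m * d m)%:E <=
    (W N E + drift_Pt)%:E + P f E)%E.
Proof.
move=> F0 f0 pE d0 Fdf.
have lQ m := lower_linear_iter m lower_linear_Qop.
have t0 m g : ge0 g -> (0 <= (wgt m)%:E * iter m Q g E)%E.
  by move=> g0; rewrite mule_ge0// (ll_ge0 (lQ m)).
have wd0 m : (0 <= (wgt m * d m)%:E)%E by rewrite EFinM mule_ge0// lee_fin.
have W0 : 0 <= W N E by exact: W_ge0.
have D0 := drift_ge0.
have mass : (\sum_(m <oo) (wgt m * (W N E + m%:R * drift))%:E <=
    (W N E + drift_Pt)%:E)%E.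
  have s1 := poisson_series (ltW x0) (@ler01 R).
  have s2 := poisson_series (ltW x0) (@ler0n R 2).
  rewrite mulr1 addNr expR0 in s1.
  have e2 : - (lam N K * h) + lam N K * h * 2 = lam N K * h by ring.
  rewrite e2 in s2.
  have -> : ((W N E + drift_Pt)%:E =
    (W N E)%:E * \sum_(m <oo) (wgt m * 1 ^+ m)%:E +
    drift%:E * \sum_(m <oo) (wgt m * 2 ^+ m)%:E)%E.
    by rewrite s1 s2 mule1 -EFinM -EFinD /drift_Pt mulrC.
  have c0 (c : R) m : 0 <= c -> (0 <= (wgt m * c ^+ m)%:E)%E.
    by move=> c0; rewrite EFinM mule_ge0// lee_fin exprn_ge0.
  rewrite -!nneseriesZl; last 2 first.
  - by move=> m _; exact: c0.
  - by move=> m _; exact: c0.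
  rewrite -nneseriesD; last 2 first.
  - by move=> m _ _; rewrite mule_ge0 ?c0// lee_fin.
  - by move=> m _ _; rewrite mule_ge0 ?c0// lee_fin.
  apply: lee_nneseries => m.
    by move=> _ _; rewrite EFinM mule_ge0// lee_fin addr_ge0// mulr_ge0.
  move=> _; rewrite -!EFinM -EFinD lee_fin expr1n mulr1.
  have -> : W N E * wgt m + drift * (wgt m * 2 ^+ m) =
    wgt m * (W N E + 2 ^+ m * drift) by ring.
  apply: ler_wpM2l; first by rewrite -lee_fin.
  rewrite lerD2l ler_wpM2r//.
  by rewrite -natrX ler_nat ltnW// ltn_expl.
apply: (@le_trans _ _
  (\sum_(m <oo) ((wgt m)%:E * iter m Q F E + (wgt m * d m)%:E))%E).
  rewrite nneseriesD; last 2 first.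
  - by move=> *; exact: t0.
  - by move=> *; exact: wd0.
  rewrite leeD// -sumEFin; exact: nneseries_lim_ge.
apply: (@le_trans _ _ (\sum_(m <oo) ((wgt m * (W N E + m%:R * drift))%:E +
    (wgt m)%:E * iter m Q f E))%E).
  apply: lee_nneseries => m; first by move=> *; rewrite adde_ge0 ?t0 ?wd0.
  move=> _; rewrite [(wgt m * d m)%:E]EFinM [(wgt m * (W N E + _))%:E]EFinM.
  rewrite -!ge0_muleDr ?(ll_ge0 (lQ m))// ?lee_fin// ?addr_ge0// ?mulr_ge0//.
  by rewrite lee_wpmul2l.
rewrite nneseriesD ?leeD2r//.
- by move=> m _ _; rewrite EFinM mule_ge0// lee_fin addr_ge0// mulr_ge0.
- by move=> *; exact: t0.
Qed.

Lemma Pt_iter_le f (B C : R) E : 0 <= C -> 0 <= B -> ge0 f -> pos E ->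
  (forall m, (iter m Q f E <= (C ^+ m * B)%:E)%E) ->
  (P f E <= (expR (- (lam N K * h) + lam N K * h * C) * B)%:E)%E.
Proof.
move=> C0 B0 f0 pE fC.
have lQ m := lower_linear_iter m lower_linear_Qop.
rewrite mulrC EFinM -poisson_series//; last exact: ltW.
rewrite -nneseriesZl; last first.
  by move=> m _; rewrite EFinM mule_ge0// lee_fin exprn_ge0.
rewrite PtE; apply: lee_nneseries => m.
  by move=> _ _; rewrite mule_ge0// (ll_ge0 (lQ m)).
move=> _; rewrite -EFinM mulrCA [leRHS]EFinM lee_wpmul2l// mulrC; exact: fC.
Qed.

End transition_semigroup.

(* Induction on the distance to the left bath: an exchange with [p] in
   [1/4, 3/4] moves a fixed fraction of the energy of site j+1 to site j and
   keeps every site above [eps / 2]. *)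
Lemma energy_escapes j : (j < N)%N -> forall eps, 0 < eps ->
  exists2 kappa, 0 < kappa & forall F f, ge0 F -> ge0 f ->
    (forall y, pos y -> (F y <= (W N y)%:E + f y)%E) ->
    forall E, pos E -> (forall i, (i < N)%N -> eps <= E i) ->
    (iter j.+1 Q F E + (kappa * E j)%:E <=
      (W N E + j.+1%:R * drift)%:E + iter j.+1 Q f E)%E.
Proof.
have lam'0 : 0 < (lam N K)^-1 by rewrite invr_gt0.
elim: j => [|j IH] jN eps eps0.
  (* Lower bound for the rate of the left bath when every site has energy at least [eps]. *)
  pose r := Num.min K (Num.sqrt (Num.min TL eps)).
  have r0 : 0 < r by rewrite lt_min K0 sqrtr_gt0 lt_min TL0.
  exists ((lam N K)^-1 * r / 2); first by rewrite divr_gt0// mulr_gt0.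
  move=> F f F0 f0 Ff E pE Eeps.
  have Ff' y : pos y -> (F y <= (W N y + 0)%:E + f y)%E.
    by move=> py; rewrite addr0 Ff.
  have := Qop_W_le (lexx 0) F0 f0 pE Ff'.
  rewrite add0r mul1r; apply: le_trans; rewrite leeD2l// lee_fin.
  have E00 : 0 <= E 0%N by rewrite ltW// pE.
  rewrite -[X in X <= _]mulrA [X in _ * X <= _]mulrC ler_wpM2r ?divr_ge0//.
  rewrite /clock_prob ler_wpM2l ?(ltW lam'0)//.
  rewrite /clock_rate ltnn eqxx /r /rate le_min ge_min lexx/= ge_min.
  apply/orP; right; rewrite ler_sqrt; last by rewrite le_min (ltW TL0).
  by rewrite le_min ge_min lexx/= ge_min Eeps ?orbT.
have eps20 : 0 < eps / 2 by rewrite divr_gt0.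
have [kappa k0 Hk] := IH (ltnW jN) _ eps20.
pose r := Num.min K (Num.sqrt eps).
have r0 : 0 < r by rewrite lt_min K0 sqrtr_gt0.
(* The 8 is 4 times 2: at least a quarter of the energy of site [j.+1] reaches site [j], for [p] in
   a window of length 1/2. *)
exists ((lam N K)^-1 * r * (kappa / 8)); first by rewrite !mulr_gt0.
move=> F f F0 f0 Ff E pE Eeps.
have lQ := lower_linear_iter j.+1 lower_linear_Qop.
pose good y := forall i, (i < N)%N -> eps / 2 <= y i.
(* The loss supplied by the induction hypothesis, set to zero where the energies are too low for it;
   the estimate [step] then holds at every positive state. *)
pose phi (y : state R) : \bar R := (if `[< good y >] then kappa * y j else 0)%:E.
have phi0 : ge0 phi.
  move=> y py; rewrite lee_fin; case: ifP => // _.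
  by rewrite mulr_ge0 ?(ltW k0)// ltW// py// ltnW.
have F1 := ll_ge0 lQ F0; have f1 := ll_ge0 lQ f0.
have G0 : ge0 (fun y => iter j.+1 Q F y + phi y)%E.
  by move=> y py; rewrite adde_ge0 ?F1 ?phi0.
have c0 : 0 <= j.+1%:R * drift by rewrite mulr_ge0// drift_ge0.
have step y : pos y -> (iter j.+1 Q F y + phi y <=
    (W N y + j.+1%:R * drift)%:E + iter j.+1 Q f y)%E.
  move=> py; rewrite /phi; case: asboolP => gy; first exact: Hk.
  by rewrite adde0; exact: iter_Qop_W_le.
have := Qop_W_le c0 G0 f1 pE step.
rewrite -[X in (W N E + (_ + X))%R]mul1r -mulrDl natr1; apply: le_trans.
apply: (@le_trans _ _ (Q (fun y => iter j.+1 Q F y + phi y) E)%E); last first.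
  rewrite leeDl// lee_fin mulr_ge0 ?clock_prob_ge0//.
  by rewrite divr_ge0// ltW// pE.
(* Superadditivity isolates [phi], of which only the contribution of clock [j] is then kept. *)
apply: le_trans _ (ll_superadd lower_linear_Qop F1 phi0 pE).
rewrite leeD2l//.
have jn : (j < n)%N by rewrite ltn_predRL.
apply: le_trans _ (Qop_ge_avg phi0 pE (leq_trans jn _)); last first.
  by rewrite -addn3 leq_addr.
have EjS0 : 0 < E j.+1 by exact: pE.
have Ej0 : 0 < E j by apply: pE; exact: ltnW.
apply: (@le_trans _ _ ((prob j E)%:E * (kappa / 4 * E j.+1 / 2)%:E)%E).
  rewrite -!EFinM lee_fin /clock_prob -!mulrA ler_wpM2l ?(ltW lam'0)//.
  have -> : r * (kappa * (8^-1 * E j.+1)) = (kappa * (4^-1 * (E j.+1 / 2))) * r.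
    by field.
  rewrite [leRHS]mulrC ler_wpM2l//; first by rewrite !mulr_ge0// ltW.
  rewrite /clock_rate jn /r /rate le_min ge_min lexx/= ge_min.
  apply/orP; right; rewrite ler_sqrt; last by rewrite le_min !ltW.
  by rewrite le_min !Eeps// ltnW.
rewrite lee_wpmul2l ?lee_fin ?clock_prob_ge0// /avg jn /avg2.
rewrite -integral_middle_half; last by rewrite !mulr_ge0// ltW.
apply: integral_ge0_mono => p /=.
  by move=> _; rewrite lee_fin !mulr_ge0// ltW.
rewrite in_itv/= => /andP[p0 p1]; rewrite indicE.
case: (boolP (p \in _)) => /=; last first.
  move=> _; rewrite mulr0; apply: phi0; apply: posstate_upd2 => //.
  by rewrite p0.
rewrite inE/= in_itv/= => /andP[p14 p34]; rewrite mulr1.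
have Ejeps : eps <= E j by apply: Eeps; exact: ltnW.
have ESeps : eps <= E j.+1 by exact: Eeps.
rewrite /phi asboolT.
  rewrite lee_fin -mulrA ler_wpM2l ?(ltW k0)// /upd2 eqxx; nra.
by move=> i iN; rewrite /upd2; case: eqP => _; [nra|case: eqP => _; [nra|]];
  have := Eeps _ iN; lra.
Qed.

(** * Growth of V *)

Section negative_powers.
Variable eta : R.
Hypothesis eta01 : 0 < eta < 1.
Local Notation V := (Vfun N eta).

Let eta0 : 0 < eta. Proof. by case/andP: eta01. Qed.
Let eta1 : eta < 1. Proof. by case/andP: eta01. Qed.

(** Hence all exponents in [Vfun] lie between [eta / 2 - 1] and [eta - 1]: negative, and above -1 by
    a uniform margin. *)
Lemma a_coef_itv m : (0 < m <= N)%N -> 2^-1 <= a_coef R N m <= 1.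
Proof.
move=> /andP[m0 mN].
have A1 : (1 : R) <= (2 ^ m.-1)%:R by rewrite ler1n expn_gt0.
have AB : 2 * (2 ^ m.-1)%:R <= (2 ^ N)%:R :> R.
  by rewrite -natrM -expnS prednK// ler_nat leq_pexp2l.
rewrite /a_coef; move: ((2 ^ m.-1)%:R : R) ((2 ^ N)%:R : R) A1 AB => A B A1 AB.
have B1 : 0 < B - 1 by lra.
have r0 : 0 <= (A - 1) / (B - 1) by rewrite divr_ge0 ?(ltW B1)// subr_ge0.
have r2 : (A - 1) / (B - 1) <= 2^-1 by rewrite ler_pdivrMr//; lra.
by move: r0 r2; lra.
Qed.

Lemma block_gt0 E m k : pos E -> (0 < m)%N -> (k + m <= N)%N ->
  0 < \sum_(0 <= j < m) E (k + j)%N.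
Proof.
move=> pE; case: m => // m _ kmN.
rewrite big_nat_recl// ltr_pwDl//.
  by apply: pE; rewrite addn0 (leq_trans _ kmN)// addnS ltnS leq_addr.
rewrite big_nat sumr_ge0// => j /= jm; rewrite ltW// pE//.
by rewrite (leq_trans _ kmN)// ltn_add2l.
Qed.

Lemma Vfun_ge0 E : 0 <= V E.
Proof. by do 2 apply: sumr_ge0 => ? _; exact: powR_ge0. Qed.

(** Every block sum shrinks by a factor at least [q]; the exponents are negative and [q] is at most
    1, so the smallest possible exponent gives the worst factor. *)
Lemma Vfun_le_scale (q : R) E E' : pos E -> 0 < q <= 1 ->
  (forall j, (j < N)%N -> q * E j <= E' j) ->
  V E' <= q `^ (eta / 2 - 1) * V E.
Proof.
move=> pE /andP[q0 q1] qE; rewrite /Vfun mulr_sumr.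
apply: ler_sum_nat => m /andP[m1 mN]; rewrite mulr_sumr.
apply: ler_sum_nat => k /= kN.
have kmN : (k + m <= N)%N.
  by rewrite addnC -leq_subRL// -ltnS -[(N - m).+1]addn1.
set B := \sum_(0 <= j < m) E (k + j)%N.
set B' := \sum_(0 <= j < m) E' (k + j)%N.
have B0 : 0 < B by exact: block_gt0.
have qB0 : 0 < q * B by rewrite mulr_gt0.
have qB : q * B <= B'.
  rewrite /B mulr_sumr; apply: ler_sum_nat => j /= jm; apply: qE.
  by rewrite (leq_trans _ kmN)// ltn_add2l.
have /andP[a2 a1] := @a_coef_itv m (introT andP (conj m1 mN)).
set e := a_coef R N m * eta - 1.
have e0 : 0 <= - e.
  by rewrite /e opprB subr_ge0 (le_trans _ (ltW eta1))// ler_piMl// ltW.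
have -> : e = - (- e) by rewrite opprK.
apply: (@le_trans _ _ ((q * B) `^ (- - e))).
  rewrite 2!(powRN _ (- e)) lef_pV2 ?posrE ?powR_gt0//; last first.
    exact: lt_le_trans qB0 qB.
  by rewrite ge0_ler_powR// nnegrE ltW// (lt_le_trans qB0 qB).
rewrite powRM ?(ltW q0) ?(ltW B0)// ler_wpM2r ?powR_ge0// opprK.
by apply: ger_powR; rewrite ?q0// lerD2r mulrC ler_wpM2r// ltW.
Qed.

(** Twice [(eta / 2)^-1], which bounds the integral over the unit interval of the power
    [eta / 2 - 1] of [p], and likewise of [1 - p]. *)
Definition Vgrowth : R := 4 / eta.

Let b0 : 0 < eta / 2. Proof. exact: divr_gt0. Qed.

Let Vgrowth_ge1 : 1 <= Vgrowth.
Proof.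
by rewrite /Vgrowth ler_pdivlMr// mul1r (le_trans (ltW eta1))// ler1n.
Qed.

(** An exchange leaves each site with at least the fraction min(p, 1 - p) of its energy, and a bath
    leaves at least the fraction p. [Vfun_le_scale] turns this into an integrable power. *)
Lemma avg_V_le k E : pos E ->
  (avg k (fun y => (V y)%:E) E <= (Vgrowth * V E)%:E)%E.
Proof.
move=> pE; have VE := Vfun_ge0 E.
have m1 D : measurable_fun (D : set R) (fun p : R => p `^ (eta / 2 - 1)).
  by apply: measurable_funTS; exact: measurable_powR.
have m2 D : measurable_fun (D : set R) (fun p : R => (1 - p) `^ (eta / 2 - 1)).
  apply: measurable_funTS; apply: (measurableT_comp (measurable_powR _)).
  by apply: measurable_funB.
have half : (eta / 2)^-1 <= Vgrowth.
  rewrite /Vgrowth invf_div; apply: ler_wpM2r; first by rewrite invr_ge0 ltW.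
  by rewrite ler_nat.
have two : (eta / 2)^-1 + (eta / 2)^-1 = Vgrowth.
  by rewrite /Vgrowth invf_div -mulrDl; congr (_ / _); lra.
rewrite /avg; case: ifPn => kn.
  apply: (@le_trans _ _ (\int[mu]_(p in `]0%R, 1%R[)
    ((V E)%:E * ((p `^ (eta / 2 - 1))%:E + ((1 - p) `^ (eta / 2 - 1))%:E)))%E).
    apply: integral_ge0_mono => p /=; first by rewrite lee_fin Vfun_ge0.
    rewrite in_itv/= => /andP[p0 p1]; rewrite -EFinD -EFinM lee_fin mulrC.
    have p1' : 0 < 1 - p by rewrite subr_gt0.
    have minp (q : R) : q <= p -> q <= 1 - p -> 0 < q <= 1 ->
        V (upd2 E k p) <= q `^ (eta / 2 - 1) * V E.
      move=> qp qp1 /andP[q0 q1]; apply: Vfun_le_scale; rewrite ?q0//.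
      move=> j jN; have Ek := pE _ (ltnW (nSN kn)); have EkS := pE _ (nSN kn).
      have Ej := pE _ jN.
      rewrite /upd2; case: eqP => [->|_]; first by nra.
      by case: eqP => [->|_]; nra.
    (* The power at the smaller of [p] and [1 - p] is bounded by the sum of both powers. *)
    case: (leP p (1 - p)) => pp.
      apply: le_trans (minp p (lexx p) pp _) _; first by rewrite p0 ltW.
      by rewrite ler_wpM2r// lerDl powR_ge0.
    apply: le_trans (minp (1 - p) (ltW pp) (lexx _) _) _.
      by rewrite p1' gerBl ltW.
    by rewrite ler_wpM2r// lerDr powR_ge0.
  rewrite ge0_integralZl//=; last 2 first.
  - by apply: emeasurable_funD; apply/measurable_EFinP; [exact: m1|exact: m2].
  - by move=> p _; rewrite adde_ge0// lee_fin powR_ge0.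
  rewrite ge0_integralD//=; last 4 first.
  - by move=> p _; rewrite lee_fin powR_ge0.
  - by apply/measurable_EFinP; exact: m1.
  - by move=> p _; rewrite lee_fin powR_ge0.
  - by apply/measurable_EFinP; exact: m2.
  rewrite [leRHS]EFinM [leRHS]muleC lee_wpmul2l ?lee_fin// -two EFinD leeD//.
    exact: integral_powR01_le.
  exact: integral_powR01_onem_le.
have bath T i : 0 < T -> (i < N)%N ->
    (avg1 T i (fun y => (V y)%:E) E <= (Vgrowth * V E)%:E)%E.
  move=> T0 iN.
  apply: (@le_trans _ _ (\int[mu]_(p in `]0%R, 1%R[)
      ((V E)%:E * (p `^ (eta / 2 - 1))%:E))%E).
    apply: integral_ge0_mono => p /=.
      move=> _; apply: integral_ge0 => x _.
      by rewrite -EFinM lee_fin mulr_ge0 ?expdens_ge0 ?Vfun_ge0.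
    rewrite in_itv/= => /andP[p0 p1].
    apply: (@le_trans _ _ (\int[mu]_(x in `]0%R, +oo[)
      ((V E * p `^ (eta / 2 - 1))%:E * (expdens T x)%:E))%E).
      apply: integral_ge0_mono => x /=.
        by move=> _; rewrite -EFinM lee_fin mulr_ge0 ?expdens_ge0 ?Vfun_ge0.
      rewrite in_itv/= andbT => x0.
      rewrite muleC lee_wpmul2r ?lee_fin ?expdens_ge0// [leRHS]mulrC.
      apply: Vfun_le_scale; rewrite ?p0 ?(ltW p1)// => j jN.
      have Ej := pE _ jN; rewrite /upd1; case: eqP => [->|_].
        by rewrite ler_wpM2l ?(ltW p0)// lerDl ltW.
      by rewrite ler_piMl// ltW.
    rewrite ge0_integralZl//=; last 3 first.
    - by apply/measurable_EFinP; exact: measurable_expdens.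
    - by move=> x _; rewrite lee_fin expdens_ge0.
    - by rewrite lee_fin mulr_ge0// powR_ge0.
    rewrite -EFinM -[leRHS]mule1 lee_wpmul2l ?lee_fin ?mulr_ge0 ?powR_ge0//.
    exact: integral_expdens_le1.
  rewrite ge0_integralZl//=; last 2 first.
  - by apply/measurable_EFinP; exact: m1.
  - by move=> p _; rewrite lee_fin powR_ge0.
  rewrite [leRHS]EFinM [leRHS]muleC lee_wpmul2l ?lee_fin//.
  by apply: le_trans (integral_powR01_le b0) _; rewrite lee_fin.
do 2 (case: ifPn => _; first exact: bath).
by rewrite lee_fin ler_peMl.
Qed.

Lemma iter_Qop_V_le m E : pos E ->
  (iter m Q (fun y => (V y)%:E) E <= (Vgrowth ^+ m * V E)%:E)%E.
Proof.
have V0 : ge0 (fun y => (V y)%:E) by move=> y _; rewrite lee_fin Vfun_ge0.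
have C0 : 0 < Vgrowth by rewrite divr_gt0.
elim: m E => [|m IH] E pE; first by rewrite expr0 mul1r.
have Vm := ll_ge0 (lower_linear_iter m lower_linear_Qop) V0.
have Cm : 0 < Vgrowth ^+ m by rewrite exprn_gt0.
rewrite [iter _ _ _]/=.
apply: (@le_trans _ _ (Q (fun y => (Vgrowth ^+ m)%:E * (V y)%:E)%E E)).
  apply: (ll_le lower_linear_Qop) => // y py; rewrite -EFinM; exact: IH.
apply: le_trans (ll_scale_le lower_linear_Qop Cm V0 pE) _.
rewrite exprSr -mulrA [leRHS]EFinM lee_wpmul2l ?lee_fin ?(ltW Cm)//.
by apply: Qop_avg_le => // k; exact: avg_V_le.
Qed.

(** Blocks of length one have coefficient [a_coef R N 1 = 1], so the single term [E i] to the power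
    [eta - 1] is at most [M0]; inverting the power bounds [E i] below. *)
Lemma Vfun_le_lower_bound (M0 : R) E i : 0 < M0 -> pos E -> V E <= M0 ->
  (i < N)%N -> (M0 `^ (1 - eta)^-1)^-1 <= E i.
Proof.
move=> M00 pE VM iN; have Ei := pE _ iN.
have e0 : 0 < 1 - eta by rewrite subr_gt0.
have EV : E i `^ (eta - 1) <= V E.
  rewrite /Vfun big_ltn ?ltnS//.
  have a1 : a_coef R N 1 = 1 by rewrite /a_coef expn0 subrr mul0r subr0.
  rewrite a1 mul1r (bigD1_seq i) ?iota_uniq//=; last first.
    by rewrite mem_index_iota/= subnK.
  rewrite big_nat1 addn0 -addrA lerDl addr_ge0//.
    by apply: sumr_ge0 => ? _; exact: powR_ge0.
  by do 2 apply: sumr_ge0 => ? _; exact: powR_ge0.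
rewrite -[leRHS]invrK lef_pV2 ?posrE ?invr_gt0 ?powR_gt0//.
have -> : (E i)^-1 = (E i `^ (eta - 1)) `^ (1 - eta)^-1.
  rewrite -powRrM (_ : (eta - 1) * _ = -1) ?powR_inv1 ?(ltW Ei)//.
  by rewrite -[eta - 1]opprB mulNr divff// gt_eqF.
apply: ge0_ler_powR; rewrite ?nnegrE ?powR_ge0 ?invr_ge0 ?(ltW e0) ?(ltW M00)//.
exact: le_trans EV VM.
Qed.

End negative_powers.

(** * The induced chain *)

Lemma lower_linear_sum A m (g : nat -> state R -> \bar R) : lower_linear A ->
  (forall k, ge0 (g k)) -> forall E, pos E ->
  (\sum_(0 <= k < m) A (g k) E <= A (fun y => \sum_(0 <= k < m) g k y) E)%E.
Proof.
move=> lA g0.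
have s0 j : ge0 (fun y => \sum_(0 <= k < j) g k y)%E.
  by move=> y py; rewrite sume_ge0// => k _; exact: g0.
elim: m => [|m IH] E pE.
  by rewrite big_nil; exact: (ll_ge0 lA (s0 0%N)).
rewrite big_nat_recr//=; apply: le_trans (leeD2r _ (IH _ pE)) _.
apply: le_trans (ll_superadd lA (s0 m) (g0 m) pE) _.
apply: (ll_le lA) => // y py; first by rewrite adde_ge0// ?s0 ?g0.
by rewrite big_nat_recr.
Qed.

(* First-step analysis of the return to [G], in the form of an inequality so
   that only superadditivity of the lower integral is involved. *)
Lemma excursion_sum_le h (G : set (state R)) (w : state R -> \bar R) A b m E :
  0 < h -> ge0 w -> pos E ->
  A = (fun g => Pt N TL TR K h (fun y => if `[< G y >] then 0%E else g y)) ->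
  b = Pt N TL TR K h (fun y => if `[< G y >] then w y else 0%E) ->
  (\sum_(0 <= k < m.+1) iter k A b E <=
   Pt N TL TR K h (fun y => if `[< G y >] then w y
                            else \sum_(0 <= k < m) iter k A b y) E)%E.
Proof.
move=> h0 w0 pE AE bE; have lP := lower_linear_Pt h0.
have lA : lower_linear A.
  by rewrite AE; exact: (lower_linear_comp lP (lower_linear_off G)).
have w1 : ge0 (fun y => if `[< G y >] then w y else 0%E).
  by move=> y py; case: ifP => // _; exact: w0.
have b0 : ge0 b by rewrite bE; exact: (ll_ge0 lP).
have i0 k : ge0 (iter k A b) by exact: (ll_ge0 (lower_linear_iter k lA)).
have s0 : ge0 (fun y => \sum_(0 <= k < m) iter k A b y)%E.
  by move=> y py; rewrite sume_ge0// => k _; exact: i0.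
rewrite big_nat_recl//=.
apply: le_trans (leeD2l _ (lower_linear_sum m lA i0 pE)) _.
have off0 := ll_ge0 (lower_linear_off G) s0.
rewrite {1}AE {1}bE; apply: le_trans (ll_superadd lP w1 off0 pE) _.
apply: (ll_le lP) => // y py; first by rewrite adde_ge0// ?w1 ?off0.
by case: ifP => _; rewrite ?adde0 ?add0e.
Qed.

End clocks.

(** * Contraction of the total energy under the induced kernel *)

Lemma positive_lower_bound (R : realType) (a : nat -> R) (m : nat) :
  (forall j, (j < m)%N -> 0 < a j) ->
  exists2 d, 0 < d & forall j, (j < m)%N -> d <= a j.
Proof.
elim: m => [|m IH] a0; first by exists 1.
have [|d d0 da] := IH; first by move=> j jm; apply: a0; exact: ltnW.
exists (Num.min d (a m)); first by rewrite lt_min d0 a0.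
move=> j; rewrite ltnS leq_eqVlt => /predU1P[->|jm]; first by rewrite ge_min lexx orbT.
by rewrite ge_min da.
Qed.

Unset Implicit Arguments.

Theorem theorem5p1 (R : realType) (N : nat) (TL TR : R) :
  (1 <= N)%N -> 0 < TL -> 0 < TR ->
  exists K0 : R, forall K : R, K0 < K ->
  exists eta0 : R, 0 < eta0 /\ forall eta : R, 0 < eta < eta0 ->
  exists h0 : R, 0 < h0 /\ forall h : R, 0 < h < h0 ->
  forall M0 c0 : R, 1 < M0 -> 0 < c0 ->
  (forall E : state R, posstate N E -> M0 < Vfun N eta E ->
     (Pt N TL TR K h (fun y => (Vfun N eta y)%:E) E
       <= (Vfun N eta E - c0 * Vfun N eta E `^ alpha eta)%:E)%E) ->
  exists M1 delta : R, 1 < M1 /\ 0 < delta /\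
    forall E : state R, Gset N eta M0 E -> M1 < W N E ->
      (Phat N TL TR K h eta M0 (fun y => (W N y)%:E) E
        <= ((1 - delta) * W N E)%:E)%E.
Proof.
(* For [eta] below 1/2 the exponent [alpha eta] is nonnegative; as V exceeds [M0 > 1] off [G], the
   hypothesis then gives a drift of at least [c0] there. *)
move=> N1 TL0 TR0; exists 0 => K K0; exists 2^-1; split=> [|eta /andP[eta0 eta2]].
  by rewrite invr_gt0.
exists 1; split=> [//|h /andP[h0 _] M0 c0 M01 c00 HV].
have M00 : 0 < M0 by rewrite (lt_trans _ M01).
have eta01 : 0 < eta < 1 by rewrite eta0 (lt_trans eta2)// invf_lt1// ltr1n.
have alpha0 : 0 <= alpha eta.
  by rewrite /alpha subr_ge0 invf_le1; [|rewrite mulr_gt0// subr_gt0]; lra.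
pose P := Pt N TL TR K h.
pose V := Vfun N eta.
pose G := Gset N eta M0.
pose A g := P (fun y => if `[< G y >] then 0%E else g y).
pose b := P (fun y => if `[< G y >] then (W N y)%:E else 0%E).
pose S m E := (\sum_(0 <= k < m) iter k A b E)%E.
pose B := drift_Pt N TL TR K h.
(* Chosen so that [D * c0] is at least [B]: off [G] the decrease of [D * V] pays for the growth of
   [W] over one period. *)
pose D := B / c0 + 1.
have B0 : 0 <= B by exact: drift_Pt_ge0.
have D0 : 0 < D by rewrite ltr_wpDl// divr_ge0// ltW.
have Dc : B <= D * c0 by rewrite mulrDl mul1r divfK ?gt_eqF// lerDl ltW.
have V0 y : posstate N y -> (0 <= (V y)%:E)%E.
  by move=> _; rewrite lee_fin; exact: Vfun_ge0.
have W0 (y : state R) : posstate N y -> (0 <= (W N y)%:E)%E.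
  by move=> py; rewrite lee_fin W_ge0.
pose f y := (D%:E * (V y)%:E)%E.
have f0 y : posstate N y -> (0 <= f y)%E.
  by move=> py; rewrite mule_ge0 ?V0// lee_fin ltW.
have lP := lower_linear_Pt N1 TL0 TR0 K0 h0.
have lA : lower_linear N A := lower_linear_comp lP (lower_linear_off N G).
have b_ge0 y : posstate N y -> (0 <= b y)%E.
  by apply: (ll_ge0 lP) => z pz; case: ifP => // _; exact: W0.
have i0 k y : posstate N y -> (0 <= iter k A b y)%E.
  exact: (ll_ge0 (lower_linear_iter k lA) b_ge0).
have S0 m y : posstate N y -> (0 <= S m y)%E.
  by move=> py; rewrite /S sume_ge0// => k _; exact: i0.
(* Value after one period: the energy if the chain has returned to [G], otherwise the excursion sum
   with [m] terms. *)
pose F m y := if `[< G y >] then (W N y)%:E else S m y.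
have F0 m y : posstate N y -> (0 <= F m y)%E.
  by move=> py; rewrite /F; case: ifP => _; [exact: W0|exact: S0].
have SF m E : posstate N E -> (S m.+1 E <= P (F m) E)%E.
  move=> pE; exact: (excursion_sum_le N1 TL0 TR0 K0 m h0 W0 pE erefl erefl).
have PfD E : posstate N E -> (P f E <= D%:E * P (fun y => (V y)%:E) E)%E.
  by move=> pE; exact: (ll_scale_le lP).
have notG y : posstate N y -> ~ G y -> M0 < V y.
  by move=> py nG; rewrite ltNge; apply/negP => VM; apply: nG.
(* [W + D * V] is a supersolution off [G] and bounds [W] on [G], so by induction it dominates every
   partial sum. *)
have SW m : forall y, posstate N y -> ~ G y -> (S m y <= (W N y)%:E + f y)%E.
  elim: m => [|m IH] y py nG.
    by rewrite /S big_nil adde_ge0 ?W0 ?f0.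
  have Ff z : posstate N z -> (F m z <= (W N z)%:E + f z)%E.
    move=> pz; rewrite /F; case: asboolP => [_|/IH]; last exact.
    by rewrite leeDl// f0.
  apply: le_trans (SF _ _ py) _.
  have it j : (iter j (Qop N TL TR K) (F m) y + 0%:E <=
      (W N y + j%:R * drift TL TR)%:E + iter j (Qop N TL TR K) f y)%E.
    by rewrite adde0; exact: (iter_Qop_W_le N1 TL0 TR0 K0 j (F0 m) f0 py Ff).
  have := Pt_W_le N1 TL0 TR0 K0 h0 0 (F0 m) f0 py (fun=> lexx 0) it.
  rewrite big_nil adde0 => /le_trans; apply.
  have VM := notG y py nG.
  have Pf : (P f y <= (D * (V y - c0))%:E)%E.
    apply: le_trans (PfD _ py) _; rewrite EFinM lee_wpmul2l ?lee_fin ?(ltW D0)//.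
    apply: le_trans (HV y py VM) _; rewrite lee_fin lerB// ler_peMr ?(ltW c00)//.
    rewrite -[leLHS](powRr0 (V y)) ler_powR// (le_trans (ltW M01))// ltW//.
  apply: le_trans (leeD2l _ Pf) _.
  rewrite /f -EFinM -!EFinD lee_fin mulrBr -/B; move: Dc; lra.
pose eps := (M0 `^ (1 - eta)^-1)^-1.
have eps0 : 0 < eps by rewrite invr_gt0 powR_gt0.
have GE E i : G E -> (i < N)%N -> eps <= E i.
  by move=> [pE VE] iN; exact: (Vfun_le_lower_bound N1 eta01 M00 pE VE iN).
(* Turns the escape constants of the sites into one sequence, with an arbitrary value 0 beyond the
   last site. *)
have /choice[kappa Hkappa] : forall j, exists k : R, (j < N)%N -> 0 < k /\
    forall F f : state R -> \bar R,
    (forall y, posstate N y -> (0 <= F y)%E) ->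
    (forall y, posstate N y -> (0 <= f y)%E) ->
    (forall y, posstate N y -> (F y <= (W N y)%:E + f y)%E) ->
    forall E, posstate N E -> (forall i, (i < N)%N -> eps <= E i) ->
    (iter j.+1 (Qop N TL TR K) F E + (k * E j)%:E <=
      (W N E + j.+1%:R * drift TL TR)%:E + iter j.+1 (Qop N TL TR K) f E)%E.
  move=> j; case: (ltnP j N) => jN; last by exists 0.
  by have [k k0 Hk] := energy_escapes N1 TL0 TR0 K0 jN eps0; exists k.
pose wgt := poisson_weight (lam N K * h).
have x0 : 0 < lam N K * h by rewrite mulr_gt0// mulr_gt0.
(* Energy at site [j] is lost after [j.+1] steps, hence the shifted Poisson weight; [d] is a common
   lower bound over all sites. *)
have [|d d0 dk] := @positive_lower_bound R (fun j => wgt j.+1 * kappa j) N.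
  move=> j jN; rewrite mulr_gt0 ?poisson_weight_gt0//.
  by have [] := Hkappa j jN.
pose CV := expR (- (lam N K * h) + lam N K * h * Vgrowth eta).
(* Total cost of leaving [G]: the growth of [W] over one period plus [D] times the bound on [P V] at
   a state where V is at most [M0]. *)
pose C := B + D * (CV * M0).
have C0 : 0 <= C.
  by rewrite addr_ge0// mulr_ge0 ?(ltW D0)// mulr_ge0 ?expR_ge0// ltW.
(* Above this threshold [C] is at most half of the loss [d * W], so the other half survives. *)
exists (2 + 2 * C / d), (d / 2); split; last split.
- by rewrite ltr_wpDr ?ltr1n// divr_ge0 ?(ltW d0)// mulr_ge0.
- by rewrite divr_gt0.
move=> E GE0 WM; have [pE VE] := GE0.
have bound m : (S m.+1 E <= ((1 - d / 2) * W N E)%:E)%E.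
  have Ff z : posstate N z -> (F m z <= (W N z)%:E + f z)%E.
    move=> pz; rewrite /F; case: asboolP => [_|nG]; last exact: SW.
    by rewrite leeDl// f0.
  apply: le_trans (SF _ _ pE) _.
  (* The loss attributed to exactly [j] steps; the index is shifted by one because zero steps lose
     nothing. *)
  pose g j := if j is j'.+1 then if (j' < N)%N then kappa j' * E j' else 0 else 0.
  have g0 j : 0 <= g j.
    case: j => //= j; case: ifP => // jN.
    by rewrite mulr_ge0 ?(ltW (pE _ jN))// ltW//; have [] := Hkappa j jN.
  have it j : (iter j (Qop N TL TR K) (F m) E + (g j)%:E <=
      (W N E + j%:R * drift TL TR)%:E + iter j (Qop N TL TR K) f E)%E.
    have triv : (iter j (Qop N TL TR K) (F m) E + 0%:E <=
      (W N E + j%:R * drift TL TR)%:E + iter j (Qop N TL TR K) f E)%E.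
      by rewrite adde0; exact: (iter_Qop_W_le N1 TL0 TR0 K0 j (F0 m) f0 pE Ff).
    case: j triv => //= j; case: ifPn => // jN _.
    have [_ Hk] := Hkappa j jN.
    exact: (Hk _ _ (F0 m) f0 Ff E pE (fun i => GE E i GE0)).
  have := Pt_W_le N1 TL0 TR0 K0 h0 N.+1 (F0 m) f0 pE g0 it.
  have dW : d * W N E <= \sum_(0 <= j < N.+1) wgt j * g j.
    rewrite big_nat_recl//= mulr0 add0r /W mulr_sumr big_mkord.
    apply: ler_sum => j _; rewrite ltn_ord mulrA ler_wpM2r ?dk//.
    by rewrite ltW// pE.
  have Pf : (P f E <= (D * (CV * M0))%:E)%E.
    apply: le_trans (PfD _ pE) _; rewrite EFinM lee_wpmul2l ?lee_fin ?(ltW D0)//.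
    have Vg0 : 0 <= Vgrowth eta by rewrite divr_ge0// ltW.
    have itV j : (iter j (Qop N TL TR K) (fun y => (V y)%:E) E <=
        (Vgrowth eta ^+ j * V E)%:E)%E by exact: iter_Qop_V_le.
    have VE0 : 0 <= V E by exact: Vfun_ge0.
    apply: le_trans (Pt_iter_le N1 TL0 TR0 K0 h0 Vg0 VE0 V0 pE itV) _.
    by rewrite lee_fin ler_wpM2l// expR_ge0.
  move=> H.
  have {}H : (P (F m) E + (d * W N E)%:E <= (W N E + C)%:E)%E.
    apply: (@le_trans _ _ ((W N E + B)%:E + P f E)%E).
      by apply: le_trans H; rewrite leeD2l// lee_fin.
    apply: le_trans (leeD2l _ Pf) _.
    by rewrite -EFinD lee_fin /C addrA.
  move: H; rewrite -leeBrDr// -EFinB => /le_trans; apply; rewrite lee_fin.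
  have : 2 * C / d <= W N E by move: WM; lra.
  rewrite ler_pdivrMr//; lra.
(* The series inherits the bound uniform over its partial sums; the empty one is treated apart,
   since [bound] starts at one term. *)
rewrite /Phat; apply: lime_le.
  by apply: is_cvg_nneseries => k _ _; exact: i0.
apply: nearW => -[|m]; last exact: bound.
by rewrite big_nil; apply: le_trans (bound 0%N); exact: S0.
Qed.
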